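(* Let $n\ge 1$ be an integer, $0<\alpha<n$, and $\nu>r>\frac{n}{n-\alpha}$. There exist positive constants $\bar\delta<1$ and $C\ge 1$, depending only on $n,\alpha,r$ and $\nu$, such that for any $V\in L^{\frac n\alpha}(B_3)$ with $V\ge 0$ and $\|V\|_{L^{\frac n\alpha}(B_3)}\le\bar\delta$, any $h\in L^\nu(B_2)$, and any $u\in L^r(B_3)$ with $u\ge 0$ satisfying $$u(x)\le\int_{B_3}\frac{V(y)u(y)}{|x-y|^{n-\alpha}}\,dy+h(x),\qquad x\in B_2,$$ we have $$\|u\|_{L^\nu(B_{1/2})}\le C\left(\|u\|_{L^r(B_3)}+\|h\|_{L^\nu(B_2)}\right).$$
   Context: $B_R$ denotes the ball of radius $R$ in $\mathbb{R}^n$ centered at the origin. *)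

(* Defs.v *)
From HB Require Import structures.
From mathcomp Require Import all_boot all_order all_algebra.
From mathcomp Require Import all_classical all_reals all_analysis.
From mathcomp Require Import measurable_realfun.

Set Implicit Arguments.
Unset Strict Implicit.
Unset Printing Implicit Defensive.

Import Order.TTheory GRing.Theory Num.Theory.
Import numFieldNormedType.Exports.

Local Open Scope classical_set_scope.
Local Open Scope ring_scope.

(* R^n with the Borel sigma-algebra, generated by the coordinate maps. *)
Notation euclidean R n := (n.-tuple (measurableTypeR R)).

Section cons_tuple.
Context {d : measure_display} {T : measurableType d} {n : nat}.

Definition cons_pair (p : T * n.-tuple T) : n.+1.-tuple T :=
  [tuple of p.1 :: p.2].

Lemma measurable_cons_pair : measurable_fun setT cons_pair.
Proof. exact: measurable_cons. Qed.

HB.instance Definition _ :=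
  isMeasurableFun.Build _ _ _ _ cons_pair measurable_cons_pair.

End cons_tuple.

Section pushforward_cons.
Context {d : measure_display} {T : measurableType d} {n : nat} {R : realType}.
Variables (m1 : {sigma_finite_measure set T -> \bar R})
  (m2 : {sigma_finite_measure set (n.-tuple T) -> \bar R}).

Definition cons_measure := pushforward (m1 \x m2)%E (@cons_pair d T n).

Let cons_measure0 : cons_measure set0 = 0%E.
Proof. exact: measure0. Qed.

Let cons_measure_ge0 A : (0 <= cons_measure A)%E.
Proof. exact: measure_ge0. Qed.

Let cons_measure_sigma_additive : semi_sigma_additive cons_measure.
Proof. exact: measure_semi_sigma_additive. Qed.

HB.instance Definition _ := isMeasure.Build _ _ _ cons_measure
  cons_measure0 cons_measure_ge0 cons_measure_sigma_additive.

Lemma cons_measure_sigma_finite : sigma_finite setT cons_measure.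
Proof.
have /sigma_finiteP[F [TF ndF Foo]] := sigma_finiteT m1.
have /sigma_finiteP[G [TG ndG Goo]] := sigma_finiteT m2.
pose g (t : n.+1.-tuple T) : T * n.-tuple T := (thead t, [tuple of behead t]).
have gK : cancel cons_pair g.
  by move=> [x t]; rewrite /g theadE; congr pair; apply/val_inj.
have mg : measurable_fun setT g.
  apply/measurable_fun_pairP; split; first exact: measurable_tnth.
  exact: measurable_behead.
exists (fun k => g @^-1` (F k `*` G k)).
  rewrite -preimage_bigcup (_ : \bigcup_k _ = setT) ?preimage_setT//.
  apply/seteqP; split => // -[x y] _.
  have [i _ Fix] : (\bigcup_i F i) x by rewrite -TF.
  have [j _ Gjy] : (\bigcup_j G j) y by rewrite -TG.
  exists (maxn i j) => //; split.
    by move: x Fix; exact/subsetPset/ndF/leq_maxl.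
  by move: y Gjy; exact/subsetPset/ndG/leq_maxr.
move=> k; have [mF Fk] := Foo k; have [mG Gk] := Goo k; split.
  by rewrite -[X in measurable X]setTI; apply: mg => //; exact: measurableX.
rewrite /cons_measure /pushforward -comp_preimage (_ : g \o _ = id).
  by rewrite preimage_id product_measure1E// lte_mul_pinfty// ge0_fin_numE.
exact/funext.
Qed.

HB.instance Definition _ :=
  Measure_isSigmaFinite.Build _ _ _ cons_measure cons_measure_sigma_finite.

End pushforward_cons.

Section dirac_sigma_finite.
Context {R : realType}.

Definition point_measure : set (euclidean R 0) -> \bar R := \d_[tuple].

HB.instance Definition _ := Measure.on point_measure.

Lemma point_measure_sigma_finite : sigma_finite setT point_measure.
Proof.
apply: fin_num_fun_sigma_finite; first by rewrite measure0.
by move=> A mA; rewrite /point_measure diracE.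
Qed.

HB.instance Definition _ :=
  Measure_isSigmaFinite.Build _ _ _ point_measure point_measure_sigma_finite.

End dirac_sigma_finite.

(* Lebesgue measure on R^n: the n-fold product of the Lebesgue measure on the
   line, see lebesgue_box. *)
Fixpoint lebesgue (R : realType) (n : nat) :
    {sigma_finite_measure set (euclidean R n) -> \bar R} :=
  match n with
  | 0 => point_measure
  | n'.+1 => cons_measure (@lebesgue_measure R) (lebesgue R n')
  end.

Lemma lebesgue_box (R : realType) (n : nat) (A : 'I_n -> set R) :
  (forall i, measurable (A i)) ->
  lebesgue R n [set t | forall i, A i (tnth t i)] =
  (\prod_(i < n) lebesgue_measure (A i))%E.
Proof.
elim: n A => [A _|n IH A mA].
  by rewrite big_ord0 /= /point_measure diracE mem_set// => -[].
rewrite big_ord_recl -IH//= /cons_measure /pushforward /=.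
set B := [set t : n.-tuple _ | _].
have mB : measurable B.
  rewrite (_ : B = \bigcap_(i in [set: 'I_n])
      ((fun t : n.-tuple _ => tnth t i) @^-1` A (lift ord0 i))); last first.
    by apply/seteqP; split => t /= tA i; [move=> _|]; exact: tA.
  apply: fin_bigcap_measurable => // i _.
  by rewrite -[X in measurable X]setTI; exact: measurable_tnth.
rewrite -product_measure1E//; last exact: mA.
congr (_ _); apply/seteqP; split => -[x t] /=.
  by move=> xtA; split => [|i]; [exact: (xtA ord0)|rewrite -(tnthS x)].
by move=> [xA tA] i; have [j ->|->//] := unliftP ord0 i; rewrite tnthS.
Qed.

Definition dist (R : realType) (n : nat) (x y : euclidean R n) : R :=
  Num.sqrt (\sum_(i < n) (tnth x i - tnth y i) ^+ 2).
Arguments dist {R n} x y.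

Definition centered_ball (R : realType) (n : nat) (r : R) :
    set (euclidean R n) :=
  [set x | dist x [tuple 0 | i < n] < r].
Arguments centered_ball {R} n r _.

Lemma measurable_dist (R : realType) (n : nat) (y : euclidean R n) :
  measurable_fun setT (fun x => dist x y).
Proof.
have msqrt := continuous_measurable_fun (@sqrt_continuous R).
apply: (measurableT_comp msqrt).
apply: measurable_sum => i; apply: measurable_funX; apply: measurable_funB.
  exact: measurable_tnth.
exact: measurable_cst.
Qed.

Lemma measurable_centered_ball (R : realType) (n : nat) (r : R) :
  measurable (centered_ball n r).
Proof.
rewrite -[X in measurable X]setTI.
by apply: measurable_fun_ltr => //; exact: measurable_dist.
Qed.

Definition norm_on (R : realType) (n : nat) (D : set (euclidean R n)) (p : R)
    (f : euclidean R n -> R) : \bar R :=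
  ('N[lebesgue R n]_p%:E[(EFin \o f) \_ D])%E.
Arguments norm_on {R n} D p f.

Definition Lp_on (R : realType) (n : nat) (D : set (euclidean R n)) (p : R)
    (f : euclidean R n -> R) : Prop :=
  measurable_fun D f /\ (norm_on D p f < +oo)%E.
Arguments Lp_on {R n} D p f.

(* Main.v *)
(** Write [k x y = |x - y|^(alpha - n)] and [T f = int k (x, y) V(y) f(y) dy].

    Hardy-Littlewood-Sobolev: in [int int f(x) k(x,y) g(y)] with
    [|f|_p = |g|_t = 1] one separates the region [g(y)^t <= f(x)^p] from its
    complement.  In the first one [g] is bounded by [f(x)^(p/t)], and splitting
    the kernel at the right radius gives
    [int g k(x, .) <= C (f(x)^(p/t))^(1 - t alpha / n) = C f(x)^(p - 1)], so
    that region contributes at most [C int f^p].  The other one is symmetric.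
    By duality and Hoelder's inequality [T] is bounded on [L^q] for every
    [q > n / (n - alpha)], with norm at most [C |V|_(n/alpha)].

    Localisation: multiply [u] by [w(x) = (4 - |x|^2)_+^(n - alpha)], which
    vanishes outside [B_2].  Since [w(x) k(x,y) <= c1 w(y) k(x,y) + c2], the
    function [U = w u] satisfies [U <= c1 T U + H] with
    [H = c2 int V u + w |h|] in [L^nu].

    Lifting: as [c1 T] has norm at most 1/2 on both [L^r] and [L^nu], iterating
    the inequality decomposes [U <= a_j + b_j] with [|a_j|_nu <= 2 |H|_nu] and
    [|b_j|_r <= 2^-j |U|_r].  Truncating [b_j] at a level [N], letting first [j]
    and then [N] tend to infinity, gives [|U|_nu <= 2 |H|_nu]. *)
Require Import Defs.
From mathcomp Require Import all_boot all_order all_algebra.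
From mathcomp Require Import all_classical all_reals all_analysis.
From mathcomp Require Import measurable_realfun ring lra.
Import Order.TTheory GRing.Theory Num.Theory.
Import numFieldNormedType.Exports.
Local Open Scope classical_set_scope.
Local Open Scope ring_scope.

Lemma measurable_powRf {d : measure_display} {T : measurableType d}
    {R : realType} (f : T -> R) (p : R) :
  measurable_fun setT f -> measurable_fun setT (fun x => f x `^ p).
Proof. exact: (@measurableT_comp _ _ _ _ _ _ (@powR R ^~ p)). Qed.

(** * The Hardy-Littlewood-Sobolev inequality *)

Section hardy_littlewood_sobolev.
Context {d : measure_display} {T : measurableType d} {R : realType}.
Variables (mu : {sigma_finite_measure set T -> \bar R}) (k : T -> T -> R).
Hypotheses (mk : measurable_fun setT (fun z : T * T => k z.1 z.2))
  (k_ge0 : forall x y, 0 <= k x y) (k_sym : forall x y, k x y = k y x).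
Variable beta : R.

(* For [k x y = |x - y|^(alpha - n)] and [beta = alpha / n], the exponent of [A]
   is the one dictated by scaling. *)
Variant kernel_bound (t C : R) : Prop :=
  KernelBound of forall x A (g : T -> R), 0 < A ->
    measurable_fun setT g -> (forall y, 0 <= g y <= A) ->
    (\int[mu]_y (g y `^ t)%:E <= 1)%E ->
    (\int[mu]_y (k x y * g y)%:E <= (C * A `^ (1 - t * beta))%:E)%E.

Lemma measurable_kernelr x : measurable_fun setT (k x).
Proof.
exact: (measurableT_comp mk (pair1_measurable x)).
Qed.

(** In the region [g^t <= f^p] the truncated [g] is at most [A = f(x)^(p/t)], so [kernel_bound]
    controls the inner integral by [C A^(1 - t beta)]. The relation between [p], [t] and [beta]
    turns this power into [f(x)^(p - 1)]. *)
Lemma bilinear_half (p t C : R) (f g : T -> R) :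
  0 < p -> 0 < t -> p^-1 + t^-1 = 1 + beta -> 0 <= C -> kernel_bound t C ->
  measurable_fun setT f -> measurable_fun setT g ->
  (forall x, 0 <= f x) -> (forall x, 0 <= g x) ->
  (\int[mu]_x (f x `^ p)%:E <= 1)%E -> (\int[mu]_x (g x `^ t)%:E <= 1)%E ->
  (\int[mu]_x \int[mu]_y
    (f x * (k x y * (if g y `^ t <= f x `^ p then g y else 0)))%:E <= C%:E)%E.
Proof.
move=> p0 t0 pt C0 kC mf mg f0 g0.
have mif x : measurable_fun setT
    (fun y => if g y `^ t <= f x `^ p then g y else 0).
  apply: measurable_fun_ifT => //; apply: measurable_fun_ler => //.
  exact: measurable_powRf.
have mint : measurable_fun setT (fun z : T * T =>
   (f z.1 * (k z.1 z.2 * (if g z.2 `^ t <= f z.1 `^ p then g z.2 else 0)))%:E).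
  apply/measurable_EFinP; apply: measurable_funM.
    exact: (measurableT_comp mf measurable_fst).
  apply: measurable_funM => //.
  apply: measurable_fun_ifT => //; last exact: (measurableT_comp mg).
  by apply: measurable_fun_ler; apply: (measurableT_comp (measurable_powRf _ _ _)).
have int0 z : (0 <= (f z.1 * (k z.1 z.2 *
    (if g z.2 `^ t <= f z.1 `^ p then g z.2 else 0)))%:E)%E.
  by rewrite lee_fin mulr_ge0// mulr_ge0//; case: ifP.
move=> fp gt.
apply: (@le_trans _ _ (\int[mu]_x (C * (f x `^ p))%:E)%E); last first.
  under eq_integral do rewrite EFinM.
  rewrite (ge0_integralZl_EFin _ measurableT)//.
  - by rewrite -[leRHS]mule1; apply: lee_wpmul2l; [rewrite lee_fin|exact: fp].
  - by move=> x _; rewrite lee_fin powR_ge0.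
  - by apply/measurable_EFinP; exact: measurable_powRf.
apply: (ge0_le_integral _ measurableT).
- by move=> x _; apply: integral_ge0 => y _; exact: (int0 (x, y)).
- exact: (measurable_fun_fubini_tonelli_F _ mint int0).
- by apply/measurable_EFinP/measurable_funM => //; exact: measurable_powRf.
(* [kernel_bound] asks for a positive bound [A], so the zeros of [f] are treated apart. *)
move=> x _; have [fx0|fx0] := eqVneq (f x) 0.
  under eq_integral do rewrite fx0 mul0r.
  by rewrite integral0 lee_fin mulr_ge0// powR_ge0.
have fx : 0 < f x by rewrite lt0r fx0 f0.
under eq_integral do rewrite EFinM.
rewrite ge0_integralZl_EFin//; last 2 first.
- by move=> y _; rewrite lee_fin mulr_ge0//; case: ifP.
- by apply/measurable_EFinP/measurable_funM => //; exact: measurable_kernelr.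
(* The exponents match because [(p/t)(1 - t beta) = p - 1]. *)
have -> : C * f x `^ p = f x * (C * (f x `^ (p / t)) `^ (1 - t * beta)).
  rewrite mulrCA -powRrM; congr (C * _).
  rewrite -{2}(powRr1 (f0 x)) -powRD ?fx0 ?implybT//; congr (_ `^ _).
  have : beta = p^-1 + t^-1 - 1 by rewrite pt; ring.
  by move=> ->; field; rewrite !gt_eqF.
rewrite EFinM; apply: lee_wpmul2l; first by rewrite lee_fin.
case: kC => kC; apply: kC; [|exact: mif| |].
- by rewrite powR_gt0.
- move=> y; case: ifP => [gf|_]; last by rewrite lexx powR_ge0.
  rewrite g0/= powRrM -[leLHS](powRr1 (g0 y)) -[X in _ `^ X](@divff _ t) ?gt_eqF//.
  rewrite powRrM ge0_ler_powR ?nnegrE ?powR_ge0// invr_ge0 ltW//.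
- apply: le_trans gt; apply: (ge0_le_integral _ measurableT).
  + by move=> y _; rewrite lee_fin powR_ge0.
  + by apply/measurable_EFinP; exact: measurable_powRf.
  + by apply/measurable_EFinP; exact: measurable_powRf.
  + move=> y _; case: ifP => // _; rewrite powR0 ?gt_eqF// lee_fin powR_ge0//.
Qed.

(** The regions [g^t <= f^p] and [f^p <= g^t] cover the product space. By Tonelli and the symmetry
    of the kernel, the second one is [bilinear_half] with [f] and [g] exchanged. *)
Lemma hls_bilinear (p t Cp Ct : R) (f g : T -> R) :
  0 < p -> 0 < t -> p^-1 + t^-1 = 1 + beta -> 0 <= Cp -> 0 <= Ct ->
  kernel_bound p Cp -> kernel_bound t Ct ->
  measurable_fun setT f -> measurable_fun setT g ->
  (forall x, 0 <= f x) -> (forall x, 0 <= g x) ->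
  (\int[mu]_x (f x `^ p)%:E <= 1)%E -> (\int[mu]_x (g x `^ t)%:E <= 1)%E ->
  (\int[mu]_x \int[mu]_y (f x * (k x y * g y))%:E <= (Cp + Ct)%:E)%E.
Proof.
move=> p0 t0 pt Cp0 Ct0 kCp kCt mf mg f0 g0.
pose F1 (z : T * T) :=
  (f z.1 * (k z.1 z.2 * (if g z.2 `^ t <= f z.1 `^ p then g z.2 else 0)))%:E.
pose F2 (z : T * T) :=
  (g z.2 * (k z.2 z.1 * (if f z.1 `^ p <= g z.2 `^ t then f z.1 else 0)))%:E.
have mf1 := measurableT_comp mf (@measurable_fst _ _ T T).
have mg2 := measurableT_comp mg (@measurable_snd _ _ T T).
have mfp1 := measurableT_comp (measurable_powRf _ p mf) (@measurable_fst _ _ T T).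
have mgt2 := measurableT_comp (measurable_powRf _ t mg) (@measurable_snd _ _ T T).
have mF1 : measurable_fun setT F1.
  apply/measurable_EFinP/measurable_funM => //; apply: measurable_funM => //.
  by apply: measurable_fun_ifT => //; exact: measurable_fun_ler.
have mF2 : measurable_fun setT F2.
  apply/measurable_EFinP/measurable_funM => //; apply: measurable_funM => //.
    exact: (measurableT_comp mk (@measurable_swap _ _ T T)).
  by apply: measurable_fun_ifT => //; exact: measurable_fun_ler.
have F10 z : (0 <= F1 z)%E.
  by rewrite lee_fin mulr_ge0// mulr_ge0//; case: ifP.
have F20 z : (0 <= F2 z)%E.
  by rewrite lee_fin mulr_ge0// mulr_ge0//; case: ifP.
pose F (z : T * T) := (f z.1 * (k z.1 z.2 * g z.2))%:E.
have mF : measurable_fun setT F.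
  by apply/measurable_EFinP/measurable_funM => //; exact: measurable_funM.
have F0 z : (0 <= F z)%E by rewrite lee_fin mulr_ge0// mulr_ge0.
have tp : t^-1 + p^-1 = 1 + beta by rewrite addrC.
move=> fp gt; rewrite EFinD addeC; apply: le_trans (leeD
  (bilinear_half p t Ct f g p0 t0 pt Ct0 kCt mf mg f0 g0 fp gt)
  (bilinear_half t p Cp g f t0 p0 tp Cp0 kCp mg mf g0 f0 gt fp)).
have swapE := fubini_tonelli F2 mF2 F20 (m1 := mu) (m2 := mu).
rewrite /F2/= in swapE; rewrite -swapE -(ge0_integralD _ measurableT); last 4 first.
- by move=> x _; apply: integral_ge0 => y _; exact: (F10 (x, y)).
- exact: (measurable_fun_fubini_tonelli_F _ mF1 F10).
- by move=> x _; apply: integral_ge0 => y _; exact: (F20 (x, y)).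
- exact: (measurable_fun_fubini_tonelli_F _ mF2 F20).
apply: (ge0_le_integral _ measurableT).
- by move=> x _; apply: integral_ge0 => y _; exact: (F0 (x, y)).
- exact: (measurable_fun_fubini_tonelli_F _ mF F0).
- apply: emeasurable_funD.
    exact: (measurable_fun_fubini_tonelli_F _ mF1 F10).
  exact: (measurable_fun_fubini_tonelli_F _ mF2 F20).
have mx (G : T * T -> \bar R) x : measurable_fun setT G ->
    measurable_fun setT (fun y => G (x, y)).
  by move=> mG; exact: (measurableT_comp mG (pair1_measurable x)).
move=> {fp gt swapE} x _; rewrite -(ge0_integralD _ measurableT); last 4 first.
- by move=> y _; exact: (F10 (x, y)).
- exact: (mx F1).
- by move=> y _; exact: (F20 (x, y)).
- exact: (mx F2).
apply: (ge0_le_integral _ measurableT).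
- by move=> y _; exact: (F0 (x, y)).
- exact: (mx F).
- by apply: emeasurable_funD; [exact: (mx F1)|exact: (mx F2)].
move=> y _; rewrite -EFinD lee_fin (k_sym y x).
(* At each point one of the two truncations leaves the integrand intact, and the other summand is
   nonnegative. *)
case: (leP (g y `^ t) (f x `^ p)) => [_|/ltW ->].
  by rewrite lerDl; apply: mulr_ge0 => //; apply: mulr_ge0 => //; case: ifP.
by rewrite !mulr0 add0r (mulrC (k x y)) (mulrC (k x y)) mulrCA mulrA.
Qed.

(** Monotone convergence. It reduces a bound on a possibly infinite integrand to bounds, uniform in
    [N], on bounded ones. *)
Lemma truncated_integral_le (D : set T) (I : T -> \bar R) (q : R) (K : \bar R) :
  measurable D -> measurable_fun setT I -> (forall x, (0 <= I x)%E) -> 1 <= q ->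
  (forall N, \int[mu]_(x in D) (mine (I x) N%:R%:E `^ q) <= K)%E ->
  (\int[mu]_(x in D) (I x `^ q) <= K)%E.
Proof.
move=> mD mI I0 q1 IK; have q0 : 0 < q by exact: lt_le_trans q1.
pose G (N : nat) x := (mine (I x) N%:R%:E `^ q)%E.
have mG N : measurable_fun D (G N).
  apply: (measurableT_comp (measurable_poweR q)).
  apply: measurable_mine => //; exact: measurable_funTS.
have G0 N x : D x -> (0 <= G N x)%E by move=> _; exact: poweR_ge0.
have minpos x (N : nat) : (0 <= mine (I x) N%:R%:E)%E.
  by rewrite le_min I0 lee_fin ler0n.
have ndG x : D x -> {homo G ^~ x : n m / (n <= m)%N >-> (n <= m)%E}.
  move=> _ n m nm; apply: gt0_ler_poweR; first exact: ltW.
  - by rewrite in_itv/= minpos leey.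
  - by rewrite in_itv/= minpos leey.
  - by rewrite le_min !ge_min lexx/= lee_fin ler_nat nm orbT.
have GI x : D x -> (I x `^ q <= limn (G ^~ x))%E.
  move=> Dx; have GN N : (G N x <= limn (G ^~ x))%E.
    rewrite (cvg_lim _ (ereal_nondecreasing_cvgn (ndG _ Dx)))//.
    by apply: ereal_sup_ubound; exists N.
  have [Ix|Ix] := eqVneq (I x) +oo%E.
    rewrite Ix poweRyr ?gt_eqF// leye_eq; apply/eqP/eqyP => A A0.
    (* At an infinite value the truncation at [N.+1] equals [N.+1], and its [q]-th power is at least
       as large because [1 <= q]. *)
    have [N AN] : exists N, A <= N.+1%:R :> R.
      exists (Num.truncn A); apply/ltW; exact: truncnS_gt.
    apply: le_trans (GN N.+1); rewrite /G Ix.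
    have -> : mine +oo%E N.+1%:R%:E = N.+1%:R%:E :> \bar R.
      by apply/min_idPr; rewrite leey.
    rewrite poweR_EFin lee_fin (le_trans AN)//.
    by rewrite le1r_powR// ler1n.
  have Ifin : I x \is a fin_num by rewrite ge0_fin_numE// ltey.
  (* A level above a finite value truncates nothing, so the supremum is attained there. *)
  apply: le_trans (GN (Num.truncn (fine (I x))).+1).
  apply: gt0_ler_poweR; first exact: ltW.
  - by rewrite in_itv/= I0 leey.
  - by rewrite in_itv/= minpos leey.
  - rewrite le_min lexx/= -{1}(fineK Ifin) lee_fin; exact/ltW/truncnS_gt.
apply: (@le_trans _ _ (\int[mu]_(x in D) (limn (G ^~ x)))%E).
  apply: ge0_le_integral => //.
  - by move=> x _; exact: poweR_ge0.
  - by apply: (measurableT_comp (measurable_poweR q)); exact: measurable_funTS.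
  - by apply: (emeasurable_fun_cvg G) => // x Dx; apply: ereal_nondecreasing_is_cvgn; exact: ndG.
rewrite monotone_convergence//.
apply: lime_le; first by apply: ereal_nondecreasing_is_cvgn => n m nm;
  apply: ge0_le_integral => // x Dx; [exact: G0|exact: ndG].
exact: nearW.
Qed.

(** Extended-real valued, since the potential can be infinite at some points. *)
Definition riesz (f : T -> R) (x : T) : \bar R :=
  (\int[mu]_y (k x y * f y)%:E)%E.

Lemma riesz_ge0 (f : T -> R) x : (forall y, 0 <= f y) -> (0 <= riesz f x)%E.
Proof. by move=> f0; apply: integral_ge0 => y _; rewrite lee_fin mulr_ge0. Qed.

Lemma measurable_riesz (f : T -> R) : measurable_fun setT f -> (forall y, 0 <= f y) ->
  measurable_fun setT (riesz f).
Proof.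
move=> mf f0.
have mkf : measurable_fun setT (fun z : T * T => (k z.1 z.2 * f z.2)%:E).
  apply/measurable_EFinP/measurable_funM => //.
  exact: (measurableT_comp mf (@measurable_snd _ _ T T)).
apply: (measurable_fun_fubini_tonelli_F _ mkf) => z.
by rewrite lee_fin mulr_ge0.
Qed.

(** Duality: the potential is tested against [J^(q - 1)], normalised in [L^t], where [J] is the
    potential cut off at height [N] and restricted to [D]. With [S] the integral of [J^q], the
    bilinear inequality gives [S <= S^(1/t) (Cp + Ct) P], hence [S^(1/q) <= (Cp + Ct) P]. *)
Lemma riesz_Lp_bound (q p t Cp Ct : R) (D : set T) (F : T -> R) (P : R) :
  1 < q -> 0 < p -> 0 < t -> q^-1 + t^-1 = 1 -> p^-1 = q^-1 + beta ->
  0 <= Cp -> 0 <= Ct -> kernel_bound p Cp -> kernel_bound t Ct ->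
  measurable D -> (mu D < +oo)%E ->
  measurable_fun setT F -> (forall x, 0 <= F x) -> 0 < P ->
  (\int[mu]_x (F x `^ p)%:E <= (P `^ p)%:E)%E ->
  (\int[mu]_(x in D) (riesz F x `^ q) <= (((Cp + Ct) * P) `^ q)%:E)%E.
Proof.
move=> q1 p0 t0 qt pq Cp0 Ct0 kCp kCt mD muD mF F0 P0 FP.
have q0 : 0 < q by apply: lt_trans q1.
have qn0 : q != 0 by rewrite gt_eqF.
have tn0 : t != 0 by rewrite gt_eqF.
have C0 : 0 <= (Cp + Ct) * P by rewrite mulr_ge0 ?addr_ge0// ltW.
have mI := measurable_riesz F mF F0.
have I0 x := riesz_ge0 F x F0.
apply: (truncated_integral_le D (riesz F) q) => //; first exact: ltW.
move=> N.
pose I x : \bar R := mine (riesz F x) N%:R%:E.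
have I0' x : (0 <= I x)%E by rewrite le_min I0 lee_fin ler0n.
have Ifin x : I x \is a fin_num.
  by rewrite ge0_fin_numE//; apply: le_lt_trans (ltry N%:R); rewrite ge_min lexx orbT.
pose J x := fine (I x) * \1_D x.
have J0 x : 0 <= J x by rewrite mulr_ge0// fine_ge0.
have mJ : measurable_fun setT J.
  apply: measurable_funM; last exact: measurable_indic.
  by apply: measurableT_comp => //; apply: measurable_mine.
have JI x : ((J x)%:E <= riesz F x)%E.
  rewrite /J indicE; case: (x \in D); last by rewrite mulr0.
  by rewrite mulr1 fineK// ge_min lexx.
have JN x : J x <= N%:R * \1_D x.
  by rewrite ler_wpM2r// -lee_fin fineK// ge_min lexx orbT.
have -> : (\int[mu]_(x in D) (I x `^ q) = \int[mu]_x (J x `^ q)%:E)%E.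
  rewrite integral_mkcond; apply: eq_integral => x _.
  rewrite patchE /J indicE; case: (x \in D).
    by rewrite mulr1 -poweR_EFin fineK.
  by rewrite mulr0 powR0.
set S := (\int[mu]_x (J x `^ q)%:E)%E.
have S0 : (0 <= S)%E by apply: integral_ge0 => x _; rewrite lee_fin powR_ge0.
(* The cut-off and [mu D < +oo] serve here: [J <= N 1_D] makes [S] finite, so that one may divide by
   its powers. *)
have Sfin : S \is a fin_num.
  rewrite ge0_fin_numE//.
  apply: (@le_lt_trans _ _ (\int[mu]_x ((N%:R `^ q)%:E * (\1_D x)%:E))%E).
    apply: (ge0_le_integral _ measurableT).
    - by move=> x _; rewrite lee_fin powR_ge0.
    - by apply/measurable_EFinP; exact: measurable_powRf.
    - by apply/measurable_EFinP/measurable_funM => //; exact: measurable_indic.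
    move=> x _; rewrite -EFinM lee_fin.
    apply: (@le_trans _ _ ((N%:R * \1_D x) `^ q)).
      apply: (ge0_ler_powR (ltW q0)); rewrite ?nnegrE.
      - exact: J0.
      - by rewrite mulr_ge0.
      - exact: JN.
    rewrite powRM// indicE; case: (x \in D); last by rewrite powR0// mulr0.
    by rewrite powR1.
  rewrite (ge0_integralZl_EFin _ measurableT).
  - by rewrite integral_indic// setIT lte_mul_pinfty// lee_fin powR_ge0.
  - by move=> x _; rewrite lee_fin.
  - by apply/measurable_EFinP; exact: measurable_indic.
  - exact: powR_ge0.
have [Sz|Snz] := eqVneq (fine S) 0.
  by rewrite -(fineK Sfin) Sz lee_fin powR_ge0.
have s0 : 0 < fine S by rewrite lt0r Snz fine_ge0.
set s := fine S in s0 Snz *.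
(* [Q] is the [L^t] norm of [J^(q - 1)], because [(q - 1) t = q]. *)
pose Q := s `^ t^-1.
have Q0 : 0 < Q by rewrite powR_gt0.
have Qt : Q `^ t = s by rewrite -powRrM mulVf// powRr1// ltW.
have q1t : (q - 1) * t = q.
  have -> : q - 1 = q * t^-1 by rewrite -(addrK q^-1 t^-1) (addrC t^-1) qt; field.
  by rewrite -mulrA mulVf// mulr1.
pose g x := J x `^ (q - 1) / Q.
have g0 x : 0 <= g x by rewrite divr_ge0// ?powR_ge0// ltW.
have mg : measurable_fun setT g.
  by apply: measurable_funM; [exact: measurable_powRf|exact: measurable_cst].
pose f x := F x / P.
have f0 x : 0 <= f x by rewrite divr_ge0// ltW.
have mf : measurable_fun setT f.
  by apply: measurable_funM; [exact: mF|exact: measurable_cst].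
have gt : (\int[mu]_x (g x `^ t)%:E <= 1)%E.
  under eq_integral.
    move=> x _; rewrite powRM ?invr_ge0 ?powR_ge0 ?(ltW Q0)//.
    rewrite -powRrM q1t -powR_inv1 ?(ltW Q0)// powRAC Qt powR_inv1 ?(ltW s0)//.
    rewrite mulrC EFinM; over.
  rewrite (ge0_integralZl_EFin _ measurableT).
  - by rewrite -/S -(fineK Sfin) -EFinM mulVf.
  - by move=> x _; rewrite lee_fin powR_ge0.
  - by apply/measurable_EFinP; exact: measurable_powRf.
  - by rewrite invr_ge0 ltW.
have fp : (\int[mu]_x (f x `^ p)%:E <= 1)%E.
  under eq_integral.
    move=> x _; rewrite powRM ?invr_ge0 ?(ltW P0)//.
    rewrite -powR_inv1 ?(ltW P0)// powRAC powR_inv1 ?powR_ge0//.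
    rewrite mulrC EFinM; over.
  rewrite (ge0_integralZl_EFin _ measurableT).
  - by rewrite lee_pdivrMl ?powR_gt0// mule1; exact: FP.
  - by move=> x _; rewrite lee_fin powR_ge0.
  - by apply/measurable_EFinP; exact: measurable_powRf.
  - by rewrite invr_ge0 powR_ge0.
have tp : t^-1 + p^-1 = 1 + beta by rewrite pq addrA (addrC t^-1) qt.
have B := hls_bilinear t p Ct Cp g f t0 p0 tp Ct0 Cp0 kCt kCp mg mf g0 f0 gt fp.
(* Write [J^q = J^(q - 1) J], bound the last factor by the potential of [F], and recognise [Q P]
   times the bilinear form in [g] and [f]. *)
have SB : (S <= (Q * P * (Cp + Ct))%:E)%E.
  rewrite [X in (_ <= X)%E]EFinM (addrC Cp).
  have QP0 : 0 <= Q * P by rewrite mulr_ge0// ltW.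
  apply: le_trans (lee_wpmul2l _ B); last by rewrite lee_fin.
  have mgkf : measurable_fun setT (fun z : T * T => (g z.1 * (k z.1 z.2 * f z.2))%:E).
    apply/measurable_EFinP/measurable_funM.
      exact: (measurableT_comp mg (@measurable_fst _ _ T T)).
    apply: measurable_funM => //.
    exact: (measurableT_comp mf (@measurable_snd _ _ T T)).
  have gkf0 z : (0 <= (g z.1 * (k z.1 z.2 * f z.2))%:E)%E.
    by rewrite lee_fin mulr_ge0// mulr_ge0.
  rewrite -(ge0_integralZl_EFin _ measurableT); last 3 first.
  - by move=> x _; apply: integral_ge0 => y _; exact: (gkf0 (x, y)).
  - exact: (measurable_fun_fubini_tonelli_F _ mgkf gkf0).
  - exact: QP0.
  apply: (ge0_le_integral _ measurableT).
  - by move=> x _; rewrite lee_fin powR_ge0.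
  - by apply/measurable_EFinP; exact: measurable_powRf.
  - apply: measurable_funeM.
    exact: (measurable_fun_fubini_tonelli_F _ mgkf gkf0).
  move=> x _.
  have mkf : measurable_fun setT (fun y => (k x y * f y)%:E).
    by apply/measurable_EFinP/measurable_funM => //; exact: measurable_kernelr.
  rewrite -(ge0_integralZl_EFin _ measurableT); last 3 first.
  - by move=> y _; exact: (gkf0 (x, y)).
  - exact: (measurableT_comp mgkf (pair1_measurable x)).
  - exact: QP0.
  under eq_integral.
    move=> y _; rewrite -EFinM.
    have -> : Q * P * (g x * (k x y * f y)) = J x `^ (q - 1) * (k x y * F y).
      by rewrite /g /f; field; rewrite !gt_eqF.
    rewrite EFinM; over.
  rewrite (ge0_integralZl_EFin _ measurableT); last 3 first.
  - by move=> y _; rewrite lee_fin mulr_ge0.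
  - apply/measurable_EFinP/measurable_funM => //; exact: measurable_kernelr.
  - exact: powR_ge0.
  rewrite -(mulr_powRB1 (J0 x) q0) mulrC EFinM.
  by apply: lee_wpmul2l; [rewrite lee_fin powR_ge0|exact: JI].
rewrite -(fineK Sfin) -/s lee_fin.
rewrite -(fineK Sfin) -/s lee_fin -mulrA (mulrC P) in SB.
(* Since [1/q + 1/t = 1], a factor [Q] cancels from both sides of [SB]. *)
have sQ : s = Q * s `^ q^-1.
  by rewrite /Q -powRD ?Snz ?implybT// addrC qt powRr1// ltW.
have : s `^ q^-1 <= (Cp + Ct) * P by rewrite -(ler_pM2l Q0) -sQ.
move=> /(ge0_ler_powR (ltW q0)); rewrite !nnegrE powR_ge0 => /(_ isT C0).
by rewrite -powRrM mulVf// powRr1// ltW.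
Qed.

End hardy_littlewood_sobolev.

(** * Regularity lifting *)

Section Lnorm_extra.
Context {d : measure_display} {T : measurableType d} {R : realType}.
Variable mu : {measure set T -> \bar R}.
Implicit Types (f g : T -> R) (p P : R).
Local Notation "'N_ p [ f ]" := (Lnorm mu p%:E (EFin \o f)).

Lemma Lnorm_leP f p P : 0 < p -> 0 <= P -> (forall x, 0 <= f x) ->
  ('N_p[f] <= P%:E)%E <-> (\int[mu]_x (f x `^ p)%:E <= (P `^ p)%:E)%E.
Proof.
move=> p0 P0 f0; have pn0 : p != 0 by rewrite gt_eqF.
have E : ('N_p[f] `^ p = \int[mu]_x (f x `^ p)%:E)%E.
  rewrite (poweR_Lnorm _ _ pn0); apply: eq_integral => x _.
  by rewrite /= ger0_norm// poweR_EFin.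
have N0 : ('N_p[f] \in `[0, +oo])%E by rewrite in_itv/= Lnorm_ge0 leey.
rewrite -E -poweR_EFin; split => [NP|].
  apply: (gt0_ler_poweR (ltW p0)) => //.
  by rewrite in_itv/= lee_fin P0 leey.
move=> NP; have pV : 0 <= p^-1 by rewrite invr_ge0 ltW.
rewrite -[leLHS]poweRe1 ?Lnorm_ge0// -[X in (_ <= X)%E]poweRe1 ?lee_fin//.
rewrite -(divff pn0) !poweRrM.
by apply: (gt0_ler_poweR pV) => //; rewrite in_itv/= ?lee_fin ?poweR_ge0 ?powR_ge0 leey.
Qed.

Lemma ae_le_Lnorm f g p : 0 < p -> measurable_fun setT f ->
  measurable_fun setT g -> (forall x, 0 <= f x) -> (forall x, 0 <= g x) ->
  {ae mu, forall x, f x <= g x} -> ('N_p[f] <= 'N_p[g])%E.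
Proof.
move=> p0 mf mg f0 g0 fg.
have [gy|gy] := eqVneq 'N_p[g] +oo%E; first by rewrite gy leey.
have gfin : 'N_p[g] \is a fin_num by rewrite ge0_fin_numE ?Lnorm_ge0// ltey.
rewrite -(fineK gfin); apply/Lnorm_leP => //.
  by rewrite fine_ge0// Lnorm_ge0.
apply: (@le_trans _ _ (\int[mu]_x (g x `^ p)%:E)%E).
  apply: (ae_ge0_le_integral measurableT).
  - by move=> x _; rewrite lee_fin powR_ge0.
  - by apply/measurable_EFinP; exact: measurable_powRf.
  - by move=> x _; rewrite lee_fin powR_ge0.
  - by apply/measurable_EFinP; exact: measurable_powRf.
  - apply: filterS fg => x fgx _; rewrite lee_fin.
    by apply: (ge0_ler_powR (ltW p0)); rewrite ?nnegrE.
by apply/Lnorm_leP; rewrite ?fineK// fine_ge0// Lnorm_ge0.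
Qed.

(* The hypothesis is [N.+1 ^ (q - p) * |f|_p ^ p <= eps ^ q]. *)
Lemma truncated_Lnorm_le f p q (N : nat) (eps : R) : 0 < p -> p < q -> 0 < eps ->
  measurable_fun setT f -> (forall x, 0 <= f x) ->
  ('N_p[f] <= (((eps `^ q) / N.+1%:R `^ (q - p)) `^ p^-1)%:E)%E ->
  ('N_q[(fun x => Num.min (f x) N%:R)] <= eps%:E)%E.
Proof.
move=> p0 pq eps0 mf f0; have q0 : 0 < q by exact: lt_trans pq.
have m0 x : 0 <= Num.min (f x) N%:R by rewrite le_min f0 ler0n.
move=> /(Lnorm_leP f p _ p0 (powR_ge0 _ _) f0).
(* Using [N.+1] instead of [N] keeps this divisor positive when [N = 0]. *)
have c0 : 0 < N.+1%:R `^ (q - p) :> R by rewrite powR_gt0.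
rewrite -powRrM mulVf ?gt_eqF// powRr1; last first.
  by rewrite divr_ge0 ?powR_ge0.
move=> fp; apply/Lnorm_leP; [by []|exact: ltW|by []|].
move: fp; rewrite EFinM (muleC (eps `^ q)%:E) (lee_pdivlMl _ _ c0) => fp.
apply: le_trans fp.
rewrite -(ge0_integralZl_EFin _ measurableT); last 3 first.
- by move=> x _; rewrite lee_fin powR_ge0.
- by apply/measurable_EFinP; exact: measurable_powRf.
- exact: ltW.
apply: (ge0_le_integral _ measurableT).
- by move=> x _; rewrite lee_fin powR_ge0.
- apply/measurable_EFinP; apply: measurable_powRf.
  by apply: measurable_minr => //.
- by apply/measurable_EFinP/measurable_funM => //; exact: measurable_powRf.
move=> x _; rewrite -EFinM lee_fin.
have [m00|mn0] := eqVneq (Num.min (f x) N%:R) 0.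
  by rewrite m00 powR0 ?gt_eqF// mulr_ge0// ?powR_ge0.
(* Interpolation: with [m = min(f, N)], [m^q = m^(q - p) m^p], where the first factor is at most
   [N.+1^(q - p)] and the second at most [f^p]. Splitting the exponent needs [m <> 0]. *)
rewrite -[in leLHS](subrK p q) (@powRD _ (Num.min _ _)) ?mn0 ?implybT//.
apply: ler_pM; rewrite ?powR_ge0//.
  apply: ge0_ler_powR; rewrite ?nnegrE ?subr_ge0 ?(ltW pq)//.
  by rewrite ge_min; apply/orP; right; rewrite ler_nat.
by apply: (ge0_ler_powR (ltW p0)); rewrite ?nnegrE// ge_min lexx.
Qed.

End Lnorm_extra.

(** * Iteration of the inequality and passage to the limit *)

Section lifting.
Context {d : measure_display} {T : measurableType d} {R : realType}.
Variables (mu : {sigma_finite_measure set T -> \bar R}) (k : T -> T -> R).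
Hypotheses (mk : measurable_fun setT (fun z : T * T => k z.1 z.2))
  (k_ge0 : forall x y, 0 <= k x y).
Variables (V : T -> R) (D : set T).
Hypotheses (mV : measurable_fun setT V) (V_ge0 : forall x, 0 <= V x)
  (mD : measurable D).
Implicit Types (f g : T -> R) (p P : R).
Local Notation "'N_ p [ f ]" := (Lnorm mu p%:E (EFin \o f)).
Local Notation I f := (riesz mu k (fun y => V y * f y)).

(** Stated with an integral and not with the norm of a real function, because [I f] may be infinite.
    The factor 1/2 is what drives the iteration. *)
Definition contraction p := forall f P, measurable_fun setT f ->
  (forall x, 0 <= f x) -> 0 < P -> ('N_p[f] <= P%:E)%E ->
  (\int[mu]_(x in D) (I f x `^ p) <= ((P / 2) `^ p)%:E)%E.

(* [fine] sends the value [+oo], taken on a null set only, to 0. *)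
Definition real_riesz f x := fine (I f x) * \1_D x.

Let VM_ge0 f : (forall x, 0 <= f x) -> forall x, 0 <= V x * f x.
Proof. by move=> f0 x; rewrite mulr_ge0. Qed.

Let mVM f : measurable_fun setT f -> measurable_fun setT (fun x => V x * f x).
Proof. by move=> mf; exact: measurable_funM. Qed.

Let I_ge0 f : (forall x, 0 <= f x) -> forall x, (0 <= I f x)%E.
Proof. by move=> f0 x; apply: riesz_ge0 => //; exact: VM_ge0. Qed.

Let mI f : measurable_fun setT f -> (forall x, 0 <= f x) ->
  measurable_fun setT (I f).
Proof.
by move=> mf f0; apply: measurable_riesz; [exact: mk|exact: k_ge0|exact: mVM|exact: VM_ge0].
Qed.

Lemma real_riesz_ge0 f : (forall x, 0 <= f x) -> forall x, 0 <= real_riesz f x.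
Proof. by move=> f0 x; rewrite mulr_ge0 ?fine_ge0 ?I_ge0 ?indicE. Qed.

Lemma measurable_real_riesz f : measurable_fun setT f -> (forall x, 0 <= f x) ->
  measurable_fun setT (real_riesz f).
Proof.
move=> mf f0; apply: measurable_funM; last exact: measurable_indic.
by apply: measurableT_comp => //; exact: mI.
Qed.

(** Replacing [+oo] by 0 only lowers the integral, and a finite integral of [(I f)^p] forces [I f]
    to be finite almost everywhere on [D]. *)
Lemma real_riesz_Lp p f P : 0 < p -> contraction p -> measurable_fun setT f ->
  (forall x, 0 <= f x) -> 0 < P -> ('N_p[f] <= P%:E)%E ->
  ('N_p[real_riesz f] <= (P / 2)%:E)%E /\
  {ae mu, forall x, D x -> I f x = (real_riesz f x)%:E}.
Proof.
move=> p0 cp mf f0 P0 /(cp f P mf f0 P0) IP; split.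
  apply/Lnorm_leP => //; first by rewrite divr_ge0// ltW.
    exact: real_riesz_ge0.
  apply: le_trans IP; rewrite [leRHS]integral_mkcond.
  apply: (ge0_le_integral _ measurableT).
  - by move=> x _; rewrite lee_fin powR_ge0.
  - by apply/measurable_EFinP/measurable_powRf; exact: measurable_real_riesz.
  - apply/(measurable_restrictT _ _).1 => //.
    by apply: (measurableT_comp (measurable_poweR p)); apply: measurable_funTS; exact: mI.
  move=> x _; rewrite patchE /real_riesz indicE.
  case: (x \in D); last by rewrite mulr0 powR0 ?gt_eqF.
  rewrite mulr1; have [->|Ifin] := eqVneq (I f x) +oo%E.
    by rewrite poweRyr ?gt_eqF// leey.
  by rewrite -poweR_EFin fineK// ge0_fin_numE ?I_ge0// ltey.
have : {ae mu, forall x, D x -> (I f x `^ p)%E \is a fin_num}.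
  apply: (integrable_ae mD); apply/integrableP; split.
    apply: (measurableT_comp (measurable_poweR p)); apply: measurable_funTS.
    exact: mI.
  under eq_integral do rewrite gee0_abs ?poweR_ge0//.
  by apply: le_lt_trans IP _; rewrite ltry.
apply: filterS => x Ixfin Dx; have {}Ixfin := Ixfin Dx.
rewrite /real_riesz indicE mem_set// mulr1 fineK//.
rewrite ge0_fin_numE ?I_ge0//; apply: (@lty_poweRy _ _ p); first by rewrite gt_eqF.
by rewrite -ge0_fin_numE// poweR_ge0.
Qed.

Variables (r nu : R) (U H : T -> R) (A B : R).
Hypotheses (r_ge1 : 1 <= r) (r_nu : r < nu)
  (contr_r : contraction r) (contr_nu : contraction nu)
  (mU : measurable_fun setT U) (U_ge0 : forall x, 0 <= U x)
  (U_out : forall x, ~ D x -> U x = 0)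
  (mH : measurable_fun setT H) (H_ge0 : forall x, 0 <= H x)
  (A_gt0 : 0 < A) (HA : ('N_nu[H] <= A%:E)%E)
  (B_gt0 : 0 < B) (UB : ('N_r[U] <= B%:E)%E)
  (UH : {ae mu, forall x, D x -> ((U x)%:E <= I U x + (H x)%:E)%E}).

Let r_gt0 : 0 < r. Proof. exact: lt_le_trans r_ge1. Qed.
Let nu_gt0 : 0 < nu. Proof. exact: lt_trans r_nu. Qed.

(** Inserting [U <= a + b] into [U <= I U + H] gives the next pair [I a + H], [I b]. The bound [2 A]
    is a fixed point, since [2 A / 2 + A = 2 A], while the bound on [b] is halved. *)
Lemma lifting_decomposition (j : nat) : exists a b : T -> R,
  [/\ measurable_fun setT a, forall x, 0 <= a x, measurable_fun setT b &
      forall x, 0 <= b x] /\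
  [/\ ('N_nu[a] <= (2 * A)%:E)%E, ('N_r[b] <= (B / 2 ^+ j)%:E)%E &
      {ae mu, forall x, U x <= a x + b x}].
Proof.
elim: j => [|j [a [b [[ma a0 mb b0] [aA bB Uab]]]]].
  (* At the start all of [U] is in the [L^r] part. *)
  exists (cst 0), U; split; first by split.
  split.
  - apply/Lnorm_leP => //; first by rewrite mulr_ge0// ltW.
    under eq_integral do rewrite powR0 ?gt_eqF//.
    by rewrite integral0 lee_fin powR_ge0.
  - by rewrite expr0 divr1; exact: UB.
  - by apply: nearW => x; rewrite /cst add0r.
have A2 : 0 < 2 * A by rewrite mulr_gt0.
have B2 : 0 < B / 2 ^+ j by rewrite divr_gt0// exprn_gt0.
have [NSa aeSa] := real_riesz_Lp nu a _ nu_gt0 contr_nu ma a0 A2 aA.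
have [NSb aeSb] := real_riesz_Lp r b _ r_gt0 contr_r mb b0 B2 bB.
have mSa := measurable_real_riesz a ma a0.
have mSb := measurable_real_riesz b mb b0.
exists (fun x => real_riesz a x + H x), (real_riesz b); split.
  split => //; [exact: measurable_funD| |exact: real_riesz_ge0].
  by move=> x; rewrite addr_ge0// real_riesz_ge0.
split.
- have nu1 : 1 <= nu by rewrite (le_trans r_ge1)// ltW.
  apply: le_trans (minkowski_EFin mu mSa mH nu1) _.
  rewrite [leRHS](_ : _ = (2 * A / 2)%:E + A%:E)%E.
    by apply: leeD; [exact: NSa|exact: HA].
  by rewrite -EFinD; congr EFin; field.
- by rewrite exprSr invfM mulrA; exact: NSb.
apply: filterS3 aeSa aeSb UH => x IaE IbE UIH.
(* The inequality is available on [D] only; elsewhere [U] vanishes. *)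
have [Dx|Dx] := pselect (D x); last first.
  by rewrite U_out// !addr_ge0// real_riesz_ge0.
have -> : real_riesz a x + H x + real_riesz b x =
    real_riesz a x + real_riesz b x + H x by rewrite addrAC.
rewrite -lee_fin 2!EFinD -(IaE Dx) -(IbE Dx).
apply: le_trans (UIH Dx) _; apply: leeD; last exact: lexx.
have mkV f : measurable_fun setT f ->
    measurable_fun setT (fun y => (k x y * (V y * f y))%:E).
  move=> mf; apply/measurable_EFinP/measurable_funM; last exact: mVM.
  exact: (measurableT_comp mk (pair1_measurable x)).
have kV0 f : (forall y, 0 <= f y) -> forall y, (0 <= (k x y * (V y * f y))%:E)%E.
  by move=> f0 y; rewrite lee_fin mulr_ge0// mulr_ge0.
rewrite -(ge0_integralD _ measurableT); last 4 first.
- by move=> y _; exact: kV0.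
- exact: mkV.
- by move=> y _; exact: kV0.
- exact: mkV.
apply: (ae_ge0_le_integral measurableT).
- by move=> y _; exact: kV0.
- exact: mkV.
- by move=> y _; apply: adde_ge0; exact: kV0.
- by apply: emeasurable_funD; exact: mkV.
apply: filterS Uab => y Uaby _.
by rewrite -EFinD lee_fin -!mulrDr ler_wpM2l// ler_wpM2l.
Qed.

(** Truncation gives [min(U, N) <= a + min(b, N)]. For fixed [N] the last term is small in [L^nu]
    once [b] is small in [L^r], that is, once [j] is large. *)
Lemma regularity_lifting : ('N_nu[U] <= (2 * A)%:E)%E.
Proof.
have A2 : 0 < 2 * A by rewrite mulr_gt0.
have nu1 : 1 <= nu by rewrite (le_trans r_ge1)// ltW.
apply/Lnorm_leP; [exact: nu_gt0|exact: ltW|exact: U_ge0|].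
under eq_integral do rewrite -poweR_EFin.
apply: (truncated_integral_le mu setT (EFin \o U) nu) => //.
  by apply/measurable_EFinP.
move=> N; pose W x := Num.min (U x) N%:R.
have W0 x : 0 <= W x by rewrite le_min U_ge0 ler0n.
have mW : measurable_fun setT W by exact: measurable_minr.
suff : ('N_nu[W] <= (2 * A)%:E)%E.
  move=> /(Lnorm_leP mu W nu _ nu_gt0 (ltW A2) W0); apply: le_trans.
  rewrite [leLHS](_ : _ = \int[mu]_x (W x `^ nu)%:E)%E; first exact: le_refl.
  by apply: eq_integral => x _; rewrite -poweR_EFin EFin_min.
apply/lee_addgt0Pr => eps eps0.
(* The size in [L^r] that [truncated_Lnorm_le] turns into size [eps] in [L^nu]. *)
pose eta := ((eps `^ nu) / N.+1%:R `^ (nu - r)) `^ r^-1.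
have eta0 : 0 < eta by rewrite powR_gt0 ?divr_gt0 ?powR_gt0.
have [j Bj] : exists j, B / 2 ^+ j <= eta.
  (* This [j] exceeds [B / eta], and [2^j > j]. *)
  exists (Num.truncn (B / eta)).+1.
  rewrite ler_pdivrMr ?exprn_gt0// mulrC -ler_pdivrMr//.
  apply: (le_trans (ltW (truncnS_gt _))).
  by rewrite -natrX ler_nat ltnW// ltn_expl.
have [a [b [[ma a0 mb b0] [aA bB Uab]]]] := lifting_decomposition j.
pose c x := Num.min (b x) N%:R.
have mc : measurable_fun setT c by exact: measurable_minr.
have c0 x : 0 <= c x by rewrite le_min b0 ler0n.
have Nc : ('N_nu[c] <= eps%:E)%E.
  apply: (truncated_Lnorm_le mu b r nu N eps) => //.
  by apply: le_trans bB _; rewrite lee_fin.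
apply: le_trans (leeD aA Nc).
apply: le_trans (minkowski_EFin mu ma mc nu1).
apply: ae_le_Lnorm => //.
- exact: measurable_funD.
- by move=> x; rewrite addr_ge0.
apply: filterS Uab => x Ux; rewrite /W /c /= ge_min minEle.
case: ifPn => [_|]; first by rewrite Ux.
by rewrite lerDr a0 orbT.
Qed.

End lifting.

(** * The Riesz kernel on Euclidean space *)

Section euclidean_kernel.
Context {R : realType} {n : nat}.
Implicit Types (x y : euclidean R n).
Local Notation mu := (lebesgue R n).

Lemma dist_ge0 x y : 0 <= dist x y.
Proof. exact: sqrtr_ge0. Qed.

Lemma distC x y : dist x y = dist y x.
Proof.
by congr Num.sqrt; apply: eq_bigr => i _; rewrite -sqrrN opprB.
Qed.

Lemma coord_le_dist x y i : `|tnth x i - tnth y i| <= dist x y.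
Proof.
rewrite -sqrtr_sqr ler_wsqrtr// (bigD1 i)//= lerDl.
by apply: sumr_ge0 => j _; exact: sqr_ge0.
Qed.

Lemma measurable_dist2 :
  measurable_fun setT (fun z : euclidean R n * euclidean R n => dist z.1 z.2).
Proof.
apply: (measurableT_comp (continuous_measurable_fun (@sqrt_continuous R))).
apply: measurable_sum => i; apply: measurable_funX; apply: measurable_funB.
  exact: (measurableT_comp (@measurable_tnth _ _ _ i) (@measurable_fst _ _ _ _)).
exact: (measurableT_comp (@measurable_tnth _ _ _ i) (@measurable_snd _ _ _ _)).
Qed.

Lemma measurable_distr x : measurable_fun setT (dist x).
Proof. exact: (measurableT_comp measurable_dist2 (pair1_measurable x)). Qed.

Definition dball x (rho : R) : set (euclidean R n) := [set y | dist x y < rho].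

Lemma measurable_dball x rho : measurable (dball x rho).
Proof.
rewrite -[X in measurable X]setTI.
by apply: measurable_fun_ltr => //; exact: measurable_distr.
Qed.

(** The ball lies in the cube of side [2 rho] with the same centre; the sharp volume constant does
    not matter. *)
Lemma dball_measure x rho : 0 < rho -> (mu (dball x rho) <= ((2 * rho) ^+ n)%:E)%E.
Proof.
move=> rho0.
pose A i : set R := `]tnth x i - rho, tnth x i + rho[%classic.
have mA i : measurable (A i) by exact: measurable_itv.
have AE i : (lebesgue_measure (A i) = (2 * rho)%:E)%E.
  rewrite /A lebesgue_measure_itv/= lte_fin.
  have -> : tnth x i - rho < tnth x i + rho by lra.
  by rewrite -EFinB; congr EFin; ring.
have := lebesgue_box mA.
under eq_bigr do rewrite AE.
rewrite prodEFin prodr_const card_ord => <-.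
apply: le_measure.
- by rewrite inE; exact: measurable_dball.
- rewrite inE (_ : [set t | _] = \bigcap_(i in [set: 'I_n])
      ((fun t : n.-tuple _ => tnth t i) @^-1` A i)); last first.
    by apply/seteqP; split => [t tA i _|t tA i]; [exact: tA|exact: (tA i I)].
  apply: fin_bigcap_measurable => // i _.
  rewrite -[X in measurable X]setTI.
  exact: (measurable_tnth i measurableT (mA i)).
- move=> y /= xy i; rewrite /A/= in_itv/=.
  have := le_lt_trans (coord_le_dist x y i) xy.
  rewrite ltr_norml => /andP[? ?]; by apply/andP; split; lra.
Qed.

(* [theta] is 1/2 near [x] and 2 far from it. *)
Lemma dyadic_integral x (S : set (euclidean R n)) (b theta s : R) :
  0 < b -> 0 < theta -> 0 < s -> theta `^ (n%:R - s) < 1 -> measurable S ->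
  (forall y, S y -> exists j : nat,
    b * theta ^+ j <= dist x y < 2 * (b * theta ^+ j)) ->
  (\int[mu]_(y in S) (dist x y `^ (- s))%:E <=
    (4 ^+ n * b `^ (n%:R - s) / (1 - theta `^ (n%:R - s)))%:E)%E.
Proof.
move=> b0 theta0 s0 c1 mS Sj.
have bt0 j : 0 < b * theta ^+ j by rewrite mulr_gt0// exprn_gt0.
(* On the shell of index [j] the integrand is at most its value at the inner radius; the shell is
   then enlarged to the full ball of twice that radius. *)
pose F (j : nat) y :=
  (((b * theta ^+ j) `^ (- s)) * \1_(dball x (2 * (b * theta ^+ j))) y)%:E.
have F0 j y : (0 <= F j y)%E by rewrite lee_fin mulr_ge0 ?powR_ge0.
have mF j : measurable_fun setT (F j).
  apply/measurable_EFinP/measurable_funM => //.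
  by apply: measurable_indic; exact: measurable_dball.
have mF' : measurable_fun S (fun y => \sum_(0 <= j <oo) F j y)%E.
  apply: measurable_funTS.
  apply: ge0_emeasurable_sum => //.
apply: (@le_trans _ _ (\int[mu]_(y in S) (\sum_(0 <= j <oo) F j y))%E).
  apply: (ge0_le_integral _ mS).
  - by move=> y _; rewrite lee_fin powR_ge0.
  - apply/measurable_EFinP; apply: measurable_funTS; apply: measurable_powRf.
    exact: measurable_distr.
  - exact: mF'.
  move=> y /Sj[j /andP[bd db]].
  apply: (@le_trans _ _ (F j y)).
    rewrite /F lee_fin indicE mem_set// mulr1 2!powRN lef_pV2 ?posrE ?powR_gt0//.
      by apply: (ge0_ler_powR (ltW s0)); rewrite ?nnegrE ?dist_ge0// ltW.
    exact: lt_le_trans bd.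
  rewrite (nneseries_split 0 j.+1)//; apply: le_trans (leeDl _ _).
    rewrite add0n big_nat_recr//=; apply: leeDr.
    by apply: sume_ge0.
  exact: nneseries_ge0.
apply: (@le_trans _ _ (\int[mu]_y (\sum_(0 <= j <oo) F j y))%E).
  apply: ge0_subset_integral => //.
  - by apply: ge0_emeasurable_sum.
  - by move=> y _; exact: nneseries_ge0.
rewrite (integral_nneseries _ measurableT)//.
(* With [d = b theta^j] the term is at most [d^(-s) (4 d)^n = 4^n d^(n - s)], which is geometric in
   [j]. *)
have IF j : (\int[mu]_y F j y <=
    (4 ^+ n * b `^ (n%:R - s) * (theta `^ (n%:R - s)) ^+ j)%:E)%E.
  under eq_integral do rewrite /F EFinM.
  rewrite (ge0_integralZl_EFin _ measurableT); last 3 first.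
  - by move=> y _; rewrite lee_fin.
  - by apply/measurable_EFinP/measurable_indic; exact: measurable_dball.
  - exact: powR_ge0.
  rewrite integral_indic//; last exact: measurable_dball.
  rewrite setIT.
  apply: (@le_trans _ _ (((b * theta ^+ j) `^ (- s))%:E *
      ((2 * (2 * (b * theta ^+ j))) ^+ n)%:E)%E).
    apply: lee_wpmul2l; first by rewrite lee_fin powR_ge0.
    by apply: dball_measure; rewrite mulr_gt0.
  rewrite -EFinM lee_fin mulrA -natrM exprMn mulrCA -mulrA ler_wpM2l ?exprn_ge0//.
  rewrite -(powR_mulrn n (ltW (bt0 j))) mulrC -powRD; last first.
    by rewrite (gt_eqF (bt0 j)) implybT.
  rewrite powRM ?exprn_ge0 ?(ltW b0) ?(ltW theta0)//.
  rewrite -(powR_mulrn j (ltW theta0)) [X in _ * X <= _]powRAC.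
  by rewrite (powR_mulrn j (powR_ge0 theta (n%:R - s))).
apply: (@le_trans _ _ (\sum_(0 <= j <oo)
    (4 ^+ n * b `^ (n%:R - s) * (theta `^ (n%:R - s)) ^+ j)%:E)%E).
  apply: lee_nneseries => // j _ _; apply: integral_ge0 => y _; exact: F0.
apply: lime_le.
  apply: is_cvg_nneseries => j _ _; rewrite lee_fin mulr_ge0//.
    by rewrite mulr_ge0 ?exprn_ge0 ?powR_ge0.
  by rewrite exprn_ge0// powR_ge0.
apply: nearW => N; rewrite sumEFin lee_fin.
apply: (geometric_le_lim N).
- by rewrite mulr_ge0 ?exprn_ge0 ?powR_ge0.
- exact: powR_gt0.
- by rewrite ger0_norm// powR_ge0.
Qed.

(** The least [j] satisfying the upper bound also satisfies the lower one. *)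
Lemma far_dyadic (rho x : R) : 0 < rho -> rho <= x ->
  exists j : nat, rho * 2 ^+ j <= x < 2 * (rho * 2 ^+ j).
Proof.
move=> rho0 rx.
have exj : exists j, x < 2 * (rho * 2 ^+ j).
  exists (Num.truncn (x / rho)).+1.
  rewrite mulrCA -exprS -ltr_pdivrMl// mulrC.
  apply: (lt_le_trans (truncnS_gt _)).
  by rewrite -natrX ler_nat (leq_trans (leqnSn _))// ltnW// ltn_expl.
case: (ex_minnP exj) => -[|j] xj minj; [exists 0|exists j.+1].
  by rewrite expr0 mulr1 rx; move: xj; rewrite expr0 mulr1.
rewrite xj andbT leNgt; apply/negP => xlt.
by have := minj j; rewrite mulrCA -exprS xlt ltnn => /(_ isT).
Qed.

(** The least [j] satisfying the lower bound also satisfies the upper one. Starting from [rho / 2]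
    makes the shell of index 0 end at [rho]. *)
Lemma near_dyadic (rho x : R) : 0 < x -> x < rho ->
  exists j : nat, rho / 2 * 2^-1 ^+ j <= x < 2 * (rho / 2 * 2^-1 ^+ j).
Proof.
move=> x0 xr; have rho0 : 0 < rho by exact: lt_trans xr.
have exj : exists j, rho / 2 * 2^-1 ^+ j <= x.
  exists (Num.truncn (rho / x)).+1.
  rewrite exprVn -mulrA -invfM -exprS ler_pdivrMr ?exprn_gt0//.
  rewrite mulrC -ler_pdivrMr//.
  apply: (le_trans (ltW (truncnS_gt _))).
  by rewrite -natrX ler_nat (leq_trans (leqnSn _))// ltnW// ltn_expl.
case: (ex_minnP exj) => -[|j] xj minj; [exists 0|exists j.+1].
  by rewrite xj expr0 mulr1 mulrCA divff// mulr1.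
rewrite xj/= mulrCA exprS mulrA mulrA divfK// ltNge; apply/negP => xlt.
by have := minj j; rewrite xlt ltnn => /(_ isT).
Qed.

(** * Integrals of the Riesz kernel near the diagonal and away from it *)

Variable alpha : R.
Hypotheses (n_gt0 : (0 < n)%N) (alpha_gt0 : 0 < alpha) (alpha_lt : alpha < n%:R).

(** Written as an inverse, as in the quotient of the theorem. Since 0 to a nonzero power is 0 and
    the inverse of 0 is 0, it vanishes on the diagonal. *)
Definition riesz_kernel x y : R := (dist x y `^ (n%:R - alpha))^-1.

Lemma riesz_kernel_ge0 x y : 0 <= riesz_kernel x y.
Proof. by rewrite invr_ge0 powR_ge0. Qed.

Lemma riesz_kernelC x y : riesz_kernel x y = riesz_kernel y x.
Proof. by rewrite /riesz_kernel distC. Qed.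

Lemma riesz_kernelE x y : riesz_kernel x y = dist x y `^ (- (n%:R - alpha)).
Proof. by rewrite powRN. Qed.

Lemma riesz_kernel_diag x y : dist x y = 0 -> riesz_kernel x y = 0.
Proof.
by rewrite riesz_kernelE => ->; rewrite powR0// oppr_eq0 gt_eqF// subr_gt0.
Qed.

Lemma measurable_riesz_kernel : measurable_fun setT
  (fun z : euclidean R n * euclidean R n => riesz_kernel z.1 z.2).
Proof.
under eq_fun do rewrite riesz_kernelE.
by apply: measurable_powRf; exact: measurable_dist2.
Qed.

(** The centre is removed because no dyadic shell contains it; the kernel is 0 there. *)
Definition punctured_dball x (rho : R) : set (euclidean R n) :=
  [set y | 0 < dist x y < rho].

Lemma measurable_punctured_dball x rho : measurable (punctured_dball x rho).
Proof.
rewrite (_ : punctured_dball x rho = dball x rho `&` [set y | 0 < dist x y]).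
  apply: measurableI; first exact: measurable_dball.
  rewrite -[X in measurable X]setTI.
  by apply: measurable_fun_ltr => //; exact: measurable_distr.
by apply/seteqP; split => y /=; [move=> /andP[]|case=> ? ?; apply/andP].
Qed.

(** Shells of radius [(rho/2) 2^-j], with [s = n - alpha]: the ratio [2^-alpha] is below 1. *)
Lemma near_kernel_integral x (rho : R) : 0 < rho ->
  (\int[mu]_(y in (punctured_dball x rho))
      (riesz_kernel x y)%:E <=
    (4 ^+ n * (2^-1) `^ alpha / (1 - 2^-1 `^ alpha) * rho `^ alpha)%:E)%E.
Proof.
move=> rho0.
under eq_integral do rewrite riesz_kernelE.
have := @dyadic_integral x (punctured_dball x rho)
  (rho / 2) 2^-1 (n%:R - alpha).
rewrite (_ : n%:R - (n%:R - alpha) = alpha); last by ring.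
rewrite powRM ?(ltW rho0) ?invr_ge0//.
rewrite (_ : 4 ^+ n * (rho `^ alpha * 2^-1 `^ alpha) / (1 - 2^-1 `^ alpha) =
  4 ^+ n * 2^-1 `^ alpha / (1 - 2^-1 `^ alpha) * rho `^ alpha); last by ring.
apply.
- by rewrite divr_gt0.
- by rewrite invr_gt0.
- by rewrite subr_gt0.
- rewrite [ltRHS](_ : 1 = 1 `^ alpha); last by rewrite powR1.
  apply: gt0_ltr_powR; rewrite ?nnegrE//.
  by rewrite invf_lt1// ltr1n.
- exact: measurable_punctured_dball.
- by move=> y /= /andP[]; exact: near_dyadic.
Qed.

(** Shells of radius [rho 2^j]: the ratio [2^(n - s)] is below 1 because [n < s]. *)
Lemma far_kernel_integral x (rho s : R) : 0 < rho -> n%:R < s ->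
  (\int[mu]_(y in ~` dball x rho) (dist x y `^ (- s))%:E <=
    (4 ^+ n / (1 - 2 `^ (n%:R - s)) * rho `^ (n%:R - s))%:E)%E.
Proof.
move=> rho0 ns.
rewrite (_ : 4 ^+ n / _ * _ =
  4 ^+ n * rho `^ (n%:R - s) / (1 - 2 `^ (n%:R - s))); last by rewrite mulrAC.
apply: dyadic_integral => //.
- by apply: lt_trans ns; rewrite ltr0n.
- rewrite -[n%:R - s]opprB powRN invf_lt1 ?powR_gt0//.
  rewrite [ltLHS](_ : 1 = 1 `^ (s - n%:R)); last by rewrite powR1.
  by apply: gt0_ltr_powR; rewrite ?nnegrE ?subr_gt0// ltr1n.
- by apply: measurableC; exact: measurable_dball.
- by move=> y /negP; rewrite -leNgt; exact: far_dyadic.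
Qed.

(** The kernel is split at a radius [rho]. Near [x] one uses [g <= A], far from [x] Hoelder's
    inequality with [|g|_t <= 1]; both parts scale like [A^(1 - t alpha / n)] for the right
    [rho]. *)
Lemma riesz_kernel_bound t : 1 < t -> t * alpha < n%:R ->
  exists2 C, 0 <= C & kernel_bound mu riesz_kernel (alpha / n%:R) t C.
Proof.
move=> t1 ta.
have t0 : 0 < t by exact: lt_trans t1.
have n0 : 0 < n%:R :> R by rewrite ltr0n.
have nn0 : n%:R != 0 :> R by rewrite gt_eqF.
have tn0 : t != 0 by rewrite gt_eqF.
pose t' := t / (t - 1).
have t1n0 : t - 1 != 0 by rewrite subr_eq0 gt_eqF.
have t'0 : 0 < t' by rewrite divr_gt0// subr_gt0.
have t'n0 : t' != 0 by rewrite gt_eqF.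
have tt' : t^-1 + t'^-1 = 1 by rewrite /t'; field; rewrite tn0 t1n0.
pose s := (n%:R - alpha) * t'.
(* Integrability of the [t']-th power of the kernel at infinity; this is [t alpha < n] rewritten. *)
have ns : n%:R < s.
  by rewrite /s /t' mulrA ltr_pdivlMr ?subr_gt0//; lra.
pose C1 : R := 4 ^+ n * 2^-1 `^ alpha / (1 - 2^-1 `^ alpha).
pose C2 : R := 4 ^+ n / (1 - 2 `^ (n%:R - s)).
have C10 : 0 <= C1.
  rewrite divr_ge0 ?mulr_ge0 ?exprn_ge0 ?powR_ge0// subr_ge0.
  rewrite [leRHS](_ : 1 = 1 `^ alpha); last by rewrite powR1.
  by apply: (ge0_ler_powR (ltW alpha_gt0)); rewrite ?nnegrE// invf_le1// ler1n.
have C20 : 0 <= C2.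
  rewrite divr_ge0 ?exprn_ge0// subr_ge0 -[n%:R - s]opprB powRN.
  rewrite invf_le1 ?powR_gt0//.
  rewrite [leLHS](_ : 1 = 1 `^ (s - n%:R)); last by rewrite powR1.
  by apply: ge0_ler_powR; rewrite ?nnegrE ?subr_ge0 ?(ltW ns)// ler1n.
exists (C1 + C2 `^ t'^-1); first by rewrite addr_ge0// powR_ge0.
split=> x A g A0 mg gA gt.
have g0 y : 0 <= g y by case/andP: (gA y).
(* Chosen to balance the two parts: [A rho^alpha = A^(1 - t alpha / n)]. *)
pose rho := A `^ (- t / n%:R).
have rho0 : 0 < rho by rewrite powR_gt0.
pose far y : R := riesz_kernel x y * \1_(~` dball x rho) y.
pose near y : R := riesz_kernel x y * \1_(punctured_dball x rho) y.
have mKx : measurable_fun setT (riesz_kernel x).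
  exact: (measurable_kernelr _ measurable_riesz_kernel).
have mfar : measurable_fun setT far.
  apply: measurable_funM => //; apply: measurable_indic.
  by apply: measurableC; exact: measurable_dball.
have mnear : measurable_fun setT near.
  apply: measurable_funM => //; apply: measurable_indic.
  exact: measurable_punctured_dball.
have far0 y : 0 <= far y by rewrite mulr_ge0// riesz_kernel_ge0.
have near0 y : 0 <= near y by rewrite mulr_ge0// riesz_kernel_ge0.
(* On the diagonal, which belongs to neither region, both sides are 0. *)
have split_kernel y : riesz_kernel x y * g y <= A * near y + g y * far y.
  rewrite /near /far !indicE.
  have [d0|dn0] := eqVneq (dist x y) 0.
    by rewrite riesz_kernel_diag// !mul0r !mulr0 addr0.
  have [dr|rd] := ltP (dist x y) rho.
    rewrite mem_set ?mulr1; last by rewrite /punctured_dball/= lt0r dn0 dist_ge0.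
    rewrite memNset ?mulr0 ?addr0; last by apply.
    by rewrite mulrC ler_wpM2r ?riesz_kernel_ge0//; case/andP: (gA y).
  rewrite memNset ?mulr0 ?add0r; last by rewrite /punctured_dball/= [X in _ && X]ltNge rd andbF.
  rewrite mem_set ?mulr1; last by rewrite /dball/= ltNge rd.
  by rewrite mulrC.
have near_le : (\int[mu]_y (A * near y)%:E <= (C1 * A `^ (1 - t * (alpha / n%:R)))%:E)%E.
  under eq_integral do rewrite EFinM.
  rewrite (ge0_integralZl_EFin _ measurableT); last 3 first.
  - by move=> y _; rewrite lee_fin.
  - exact/measurable_EFinP.
  - exact: ltW.
  have -> : (\int[mu]_y (near y)%:E =
      \int[mu]_(y in punctured_dball x rho) (riesz_kernel x y)%:E)%E.
    rewrite [RHS]integral_mkcond; apply: eq_integral => y _.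
    rewrite /near indicE patchE; case: (y \in _); first by rewrite mulr1.
    by rewrite mulr0.
  apply: le_trans (lee_wpmul2l _ (near_kernel_integral x rho rho0)) _.
    by rewrite lee_fin ltW.
  rewrite -EFinM lee_fin mulrCA -/C1 ler_wpM2l//.
  rewrite /rho -powRrM -{1}(powRr1 (ltW A0)) -powRD.
    2: by rewrite (gt_eqF A0) implybT.
  by rewrite (_ : 1 + - t / n%:R * alpha = 1 - t * (alpha / n%:R))//; field.
have far_le : (\int[mu]_y (g y * far y)%:E <=
    (C2 `^ t'^-1 * A `^ (1 - t * (alpha / n%:R)))%:E)%E.
  have -> : (\int[mu]_y (g y * far y)%:E = 'N[mu]_1[EFin \o (g \* far)%R])%E.
    rewrite Lnorm1; apply: eq_integral => y _.
    by rewrite /= ger0_norm// mulr_ge0.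
  apply: le_trans (hoelder mu mg mfar t0 t'0 tt') _.
  rewrite -[X in (_ <= X)%E]mul1e; apply: lee_pmul.
  - exact: Lnorm_ge0.
  - exact: Lnorm_ge0.
  - apply/(Lnorm_leP mu g t 1 t0 ler01 g0).
    by rewrite powR1; exact: gt.
  apply/(Lnorm_leP mu far t' _ t'0 _ far0).
    by rewrite mulr_ge0 ?powR_ge0.
  rewrite powRM ?powR_ge0// -!powRrM mulVf// (powRr1 C20).
  have -> : A `^ ((1 - t * (alpha / n%:R)) * t') = rho `^ (n%:R - s).
    rewrite /rho -powRrM; congr (_ `^ _); rewrite /s /t'; field.
    by rewrite nn0 t1n0.
  apply: le_trans (far_kernel_integral x rho s rho0 ns).
  rewrite [X in (_ <= X)%E]integral_mkcond.
  rewrite [X in (X <= _)%E](_ : _ = \int[mu]_y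
      ((fun y => (dist x y `^ (- s))%:E) \_ (~` dball x rho)) y)%E; first exact: le_refl.
  apply: eq_integral => y _; rewrite /far indicE patchE.
  case: (y \in _); last by rewrite mulr0 powR0.
  rewrite mulr1 riesz_kernelE -powRrM; congr (_ `^ _)%:E; rewrite /s; ring.
apply: (@le_trans _ _ (\int[mu]_y ((A * near y)%:E + (g y * far y)%:E))%E).
  apply: (ge0_le_integral _ measurableT).
  - by move=> y _; rewrite lee_fin mulr_ge0// riesz_kernel_ge0.
  - by apply/measurable_EFinP/measurable_funM.
  - by apply: emeasurable_funD; apply/measurable_EFinP/measurable_funM.
  - by move=> y _; rewrite -EFinD lee_fin.
rewrite (ge0_integralD _ measurableT).
- rewrite mulrDl EFinD; apply: leeD; [exact: near_le|exact: far_le].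
- by move=> y _; rewrite lee_fin mulr_ge0// ltW.
- by apply/measurable_EFinP/measurable_funM.
- by move=> y _; rewrite lee_fin mulr_ge0.
- by apply/measurable_EFinP/measurable_funM.
Qed.

End euclidean_kernel.

(** * Localisation *)

Section Lnorm_bounds.
Context {d : measure_display} {T : measurableType d} {R : realType}.
Variable mu : {measure set T -> \bar R}.
Implicit Types (f g : T -> R) (p q P Q : R).
Local Notation "'N_ p [ f ]" := (Lnorm mu p%:E (EFin \o f)).

Lemma Lnorm_scale_le f q (c P : R) : 0 < q -> 0 <= c -> 0 <= P ->
  measurable_fun setT f -> (forall x, 0 <= f x) -> ('N_q[f] <= P%:E)%E ->
  ('N_q[(fun x => c * f x)%R] <= (c * P)%:E)%E.
Proof.
move=> q0 c0 P0 mf f0 /(Lnorm_leP mu f q P q0 P0 f0) fP.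
apply/Lnorm_leP; [by []|exact: mulr_ge0|by move=> x; rewrite mulr_ge0|].
under eq_integral do rewrite (powRM _ c0 (f0 _)) EFinM.
rewrite (ge0_integralZl_EFin _ measurableT).
- rewrite powRM// EFinM; apply: lee_wpmul2l; last exact: fP.
  by rewrite lee_fin powR_ge0.
- by move=> x _; rewrite lee_fin powR_ge0.
- by apply/measurable_EFinP; exact: measurable_powRf.
- exact: powR_ge0.
Qed.

Lemma Lnorm_indic_le q (D : set T) : 0 < q -> measurable D -> (mu D < +oo)%E ->
  ('N_q[\1_D] <= (fine (mu D) `^ q^-1)%:E)%E.
Proof.
move=> q0 mD muD; have mufin : mu D \is a fin_num by rewrite ge0_fin_numE.
apply/Lnorm_leP; [by []|exact: powR_ge0|by move=> x; rewrite indicE|].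
rewrite -powRrM mulVf ?gt_eqF// powRr1 ?fine_ge0// fineK//.
rewrite (_ : (fun x => _) = (fun x => (\1_D x)%:E)).
  by rewrite integral_indic// setIT.
apply/funext => x; rewrite indicE; case: (x \in D); first by rewrite powR1.
by rewrite powR0 ?gt_eqF.
Qed.

(** Hoelder's inequality for [f^p] and [g^p] with the conjugate exponents [a / p] and [b / p]. *)
Lemma Lnorm_mul_le f g p (a b P Q : R) : 0 < p -> 0 < a -> 0 < b ->
  p^-1 = a^-1 + b^-1 -> 0 <= P -> 0 <= Q ->
  measurable_fun setT f -> measurable_fun setT g ->
  (forall x, 0 <= f x) -> (forall x, 0 <= g x) ->
  ('N_a[f] <= P%:E)%E -> ('N_b[g] <= Q%:E)%E ->
  ('N_p[(fun x => f x * g x)%R] <= (P * Q)%:E)%E.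
Proof.
move=> p0 a0 b0 pab P0 Q0 mf mg f0 g0 fP gQ.
have pn0 : p != 0 by rewrite gt_eqF.
apply/Lnorm_leP; [by []|exact: mulr_ge0|by move=> x; rewrite mulr_ge0|].
have -> : (\int[mu]_x ((f x * g x) `^ p)%:E =
   'N[mu]_1[EFin \o ((fun x => f x `^ p) \* (fun x => g x `^ p))%R])%E.
  rewrite Lnorm1; apply: eq_integral => x _ /=.
  by rewrite powRM// ger0_norm// mulr_ge0// powR_ge0.
have ap0 : 0 < a / p by rewrite divr_gt0.
have bp0 : 0 < b / p by rewrite divr_gt0.
have abp : (a / p)^-1 + (b / p)^-1 = 1.
  by rewrite !invf_div -mulrDr -pab divff.
apply: le_trans (hoelder mu (measurable_powRf f p mf)
  (measurable_powRf g p mg) ap0 bp0 abp) _.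
rewrite powRM// [X in (_ <= X)%E]EFinM; apply: lee_pmul; [exact: Lnorm_ge0|exact: Lnorm_ge0| |].
- apply/Lnorm_leP; [by []|exact: powR_ge0|by move=> x; rewrite powR_ge0|].
  rewrite -powRrM mulrCA divff// mulr1.
  under eq_integral do rewrite -powRrM mulrCA divff// mulr1.
  by move/(Lnorm_leP mu f a P a0 P0 f0) : fP.
- apply/Lnorm_leP; [by []|exact: powR_ge0|by move=> x; rewrite powR_ge0|].
  rewrite -powRrM mulrCA divff// mulr1.
  under eq_integral do rewrite -powRrM mulrCA divff// mulr1.
  by move/(Lnorm_leP mu g b Q b0 Q0 g0) : gQ.
Qed.

End Lnorm_bounds.

(** * The potential of [V f], and the localising weight *)

Section euclidean_regularity.
Context {R : realType} {n : nat}.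
Variable alpha : R.
Hypotheses (n_gt0 : (0 < n)%N) (alpha_gt0 : 0 < alpha) (alpha_lt : alpha < n%:R).
Local Notation mu := (lebesgue R n).
Local Notation k := (riesz_kernel alpha).
Local Notation "'N_ p [ f ]" := (Lnorm mu p%:E (EFin \o f)).

(** Take [1/p = 1/q + alpha/n] and [t] conjugate to [q]. Then [|V f|_p <= |V|_(n/alpha) |f|_q], and
    [riesz_kernel_bound] applies to [p] and [t]: both [1 < p] and [t alpha < n] amount to
    [n < q (n - alpha)]. *)
Lemma riesz_potential_bound q : n%:R / (n%:R - alpha) < q ->
  exists2 C : R, 0 <= C &
  forall (D : set (euclidean R n)) (V f : euclidean R n -> R) (delta P : R),
    measurable D -> (mu D < +oo)%E ->
    measurable_fun setT V -> measurable_fun setT f ->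
    (forall x, 0 <= V x) -> (forall x, 0 <= f x) -> 0 < delta -> 0 < P ->
    ('N_(n%:R / alpha)[V] <= delta%:E)%E -> ('N_q[f] <= P%:E)%E ->
    (\int[mu]_(x in D) (riesz mu k (fun y => V y * f y)%R x `^ q) <=
      ((C * (delta * P)) `^ q)%:E)%E.
Proof.
move=> nq.
have n0 : 0 < n%:R :> R by rewrite ltr0n.
have nn0 : n%:R != 0 :> R by rewrite gt_eqF.
have na0 : 0 < n%:R - alpha by rewrite subr_gt0.
have an0 : alpha != 0 by rewrite gt_eqF.
have q1 : 1 < q.
  by apply: lt_trans nq; rewrite ltr_pdivlMr// mul1r gtrBl.
have q0 : 0 < q by exact: lt_trans q1.
have qn0 : q != 0 by rewrite gt_eqF.
have qan : n%:R < q * (n%:R - alpha) by rewrite -ltr_pdivrMr.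
have s0 : 0 < n%:R + q * alpha by rewrite addr_gt0// mulr_gt0.
have sn0 : n%:R + q * alpha != 0 by rewrite gt_eqF.
pose p := n%:R * q / (n%:R + q * alpha).
have p0 : 0 < p by rewrite divr_gt0// mulr_gt0.
have pq : p^-1 = q^-1 + alpha / n%:R.
  by rewrite /p; field; rewrite qn0 nn0 sn0.
have p1 : 1 < p by rewrite ltr_pdivlMr// mul1r; lra.
have pa : p * alpha < n%:R.
  rewrite /p mulrAC ltr_pdivrMr// -mulrA ltr_pM2l//.
  by rewrite -[ltLHS]add0r ltrD2r.
pose t := q / (q - 1).
have q10 : 0 < q - 1 by rewrite subr_gt0.
have t0 : 0 < t by rewrite divr_gt0.
have t1 : 1 < t by rewrite ltr_pdivlMr// mul1r gtrBl.
have ta : t * alpha < n%:R.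
  by rewrite /t mulrAC ltr_pdivrMr//; lra.
have qt : q^-1 + t^-1 = 1 by rewrite /t; field; rewrite qn0 gt_eqF.
have [Cp Cp0 kCp] := riesz_kernel_bound alpha n_gt0 alpha_gt0 alpha_lt p p1 pa.
have [Ct Ct0 kCt] := riesz_kernel_bound alpha n_gt0 alpha_gt0 alpha_lt t t1 ta.
exists (Cp + Ct); first exact: addr_ge0.
move=> D V f delta P mD muD mV mf V0 f0 delta0 P0 VD fP.
have VfP : ('N_p[(fun x => V x * f x)%R] <= (delta * P)%:E)%E.
  apply: (Lnorm_mul_le mu V f p (n%:R / alpha) q) => //.
  - by rewrite divr_gt0.
  - by rewrite pq invf_div addrC.
  - exact: ltW.
  - exact: ltW.
have dP0 : 0 < delta * P by rewrite mulr_gt0.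
have Vf0 x : 0 <= V x * f x by rewrite mulr_ge0.
move: VfP => /(Lnorm_leP mu _ p _ p0 (ltW dP0) Vf0).
apply: (riesz_Lp_bound mu k _ _ _ _ q p t Cp Ct D) => //.
- exact: measurable_riesz_kernel.
- exact: riesz_kernel_ge0.
- exact: riesz_kernelC.
- exact: pq.
- exact: kCp.
- exact: kCt.
- exact: measurable_funM.
Qed.

Let origin : euclidean R n := [tuple 0 | i < n].

(* Using [|x|^2] instead of [|x|] makes the Lipschitz bound coordinatewise. *)
Definition bump (x : euclidean R n) : R := Num.max 0 (4 - dist x origin ^+ 2).

Lemma bump_ge0 x : 0 <= bump x.
Proof. by rewrite le_max lexx. Qed.

(** Each coordinate contributes [(y_i - x_i)(y_i + x_i)], whose second factor is at most [2 + 3 = 5]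
    in absolute value. *)
Lemma bump_lipschitz x y : dist x origin < 2 -> dist y origin < 3 ->
  bump x <= bump y + 5 * n%:R * dist x y.
Proof.
move=> x2 y3.
have sq (z : euclidean R n) : dist z origin ^+ 2 = \sum_(i < n) tnth z i ^+ 2.
  rewrite sqr_sqrtr; last by apply: sumr_ge0 => i _; exact: sqr_ge0.
  by apply: eq_bigr => i _; rewrite tnth_mktuple subr0.
have x4 : dist x origin ^+ 2 <= 4.
  rewrite (_ : 4 = 2 ^+ 2); last by rewrite -natrX.
  by rewrite lerXn2r// ?nnegrE ?dist_ge0// ltW.
rewrite {1}/bump max_r ?subr_ge0//.
have le_bump : 4 - dist y origin ^+ 2 <= bump y by rewrite le_max lexx orbT.
suff : dist y origin ^+ 2 - dist x origin ^+ 2 <= 5 * n%:R * dist x y by lra.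
rewrite !sq -sumrB.
apply: (@le_trans _ _ (\sum_(i < n) (5 * dist x y))); last first.
  by rewrite sumr_const card_ord -[leLHS]mulr_natl mulrCA mulrA.
apply: ler_sum => i _; rewrite subr_sqr mulrC.
apply: le_trans (ler_norm _) _; rewrite normrM; apply: ler_pM => //.
- apply: le_trans (ler_normD _ _) _.
  have coord (z : euclidean R n) : `|tnth z i| <= dist z origin.
    by have := coord_le_dist z origin i; rewrite tnth_mktuple subr0.
  have := coord x; have := coord y; lra.
- by rewrite distrC; exact: coord_le_dist.
Qed.

Definition weight x : R := bump x `^ (n%:R - alpha).

Lemma weight_ge0 x : 0 <= weight x. Proof. exact: powR_ge0. Qed.

Lemma measurable_weight : measurable_fun setT weight.
Proof.
apply: measurable_powRf; apply: measurable_maxr => //.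
apply: measurable_funB => //; apply: measurable_funX.
exact: measurable_dist.
Qed.

Lemma weight_le x : weight x <= 4 `^ (n%:R - alpha).
Proof.
apply: ge0_ler_powR; rewrite ?nnegrE ?bump_ge0 ?subr_ge0 ?(ltW alpha_lt)//.
by rewrite ge_max gerBl sqr_ge0 andbT.
Qed.

Lemma weight_out x : ~ centered_ball n 2 x -> weight x = 0.
Proof.
move=> /negP; rewrite -leNgt => x2; rewrite /weight /bump max_l.
  by rewrite powR0// gt_eqF// subr_gt0.
rewrite subr_le0 (_ : 4 = 2 ^+ 2); last by rewrite -natrX.
by rewrite lerXn2r// nnegrE// dist_ge0.
Qed.

Lemma weight_ge1 x : centered_ball n (1 / 2) x -> 1 <= weight x.
Proof.
rewrite /centered_ball/= => x2.
rewrite [leLHS](_ : 1 = 1 `^ (n%:R - alpha)); last by rewrite powR1.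
apply: ge0_ler_powR; rewrite ?nnegrE ?bump_ge0 ?subr_ge0 ?(ltW alpha_lt)//.
rewrite le_max; apply/orP; right.
have : dist x origin ^+ 2 <= 1 ^+ 2.
  by rewrite lerXn2r// ?nnegrE ?dist_ge0//; lra.
rewrite expr1n; lra.
Qed.

(* Multiplying by the weight costs only a bounded kernel, because the weight
   has the same homogeneity as the kernel. *)
Lemma weight_kernel : exists c1 c2 : R, [/\ 0 < c1, 0 < c2 &
  forall x y, centered_ball n 2 x -> centered_ball n 3 y ->
    weight x * k x y <= c1 * (weight y * k x y) + c2].
Proof.
have na0 : 0 < n%:R - alpha by rewrite subr_gt0.
set s := n%:R - alpha in na0.
pose L : R := 5 * n%:R.
have L0 : 0 < L by rewrite mulr_gt0// ltr0n.
have s2 : 0 < 2 `^ s :> R by rewrite powR_gt0.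
(* These come from [(a + b)^s <= 2^s (a^s + b^s)] with [a = bump y] and [b = L |x - y|]. *)
exists (2 `^ s), (2 `^ s * L `^ s); split => //.
  by rewrite mulr_gt0// powR_gt0.
move=> x y x2 y3.
have [d0|dn0] := eqVneq (dist x y) 0.
  rewrite (riesz_kernel_diag alpha alpha_lt x y d0) !mulr0 add0r.
  by rewrite mulr_ge0 ?powR_ge0.
have d0 : 0 < dist x y by rewrite lt0r dn0 dist_ge0.
have k0 : 0 < k x y by rewrite invr_gt0 powR_gt0.
have dk : dist x y `^ s * k x y = 1 by rewrite divff// gt_eqF// powR_gt0.
(* Off the diagonal [|x - y|^s k(x, y) = 1], so multiplying by the kernel turns the last term into
   the constant [c2]. *)
suff : weight x <= 2 `^ s * (weight y + L `^ s * dist x y `^ s).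
  move=> /(ler_wpM2r (ltW k0)) /le_trans; apply.
  have -> : 2 `^ s * (weight y + L `^ s * dist x y `^ s) * k x y =
    2 `^ s * (weight y * k x y) + 2 `^ s * L `^ s * (dist x y `^ s * k x y) by ring.
  by rewrite dk mulr1.
have Ld0 : 0 <= L * dist x y by rewrite mulr_ge0// ltW.
have M0 : 0 <= Num.max (bump y) (L * dist x y) by rewrite le_max bump_ge0.
apply: (@le_trans _ _ ((2 * Num.max (bump y) (L * dist x y)) `^ s)).
  apply: (ge0_ler_powR (ltW na0)); rewrite ?nnegrE ?bump_ge0 ?mulr_ge0//.
  apply: (le_trans (bump_lipschitz x y x2 y3)).
  rewrite -/L [leRHS]mulr_natl mulr2n.
  by apply: lerD; rewrite le_max lexx ?orbT.
rewrite powRM// ler_wpM2l ?powR_ge0// -powRM ?(ltW L0) ?dist_ge0//.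
case: (leP (bump y)) => _.
  by rewrite lerDr powR_ge0.
by rewrite lerDl powR_ge0.
Qed.

End euclidean_regularity.

(** * Norms over balls *)

Section norm_on.
Context {R : realType} {n : nat}.
Implicit Types (D : set (euclidean R n)) (f : euclidean R n -> R).

(** A nonnegative function on the whole space with the same norm as [f] on [D], as the preceding
    estimates require. *)
Definition abs_on D f x : R := `|(f \_ D) x|.

Lemma abs_on_ge0 D f x : 0 <= abs_on D f x.
Proof. exact: normr_ge0. Qed.

Lemma abs_on_in D f x : D x -> abs_on D f x = `|f x|.
Proof. by move=> Dx; rewrite /abs_on patchE mem_set. Qed.

Lemma abs_on_out D f x : ~ D x -> abs_on D f x = 0.
Proof. by move=> Dx; rewrite /abs_on patchE memNset// normr0. Qed.

Lemma measurable_abs_on D f : measurable D -> measurable_fun D f ->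
  measurable_fun setT (abs_on D f).
Proof.
move=> mD mf; apply: measurableT_comp => //.
by apply/(measurable_restrictT _ _).1.
Qed.

Lemma norm_onE D p f :
  norm_on D p f = ('N[lebesgue R n]_p%:E[EFin \o abs_on D f])%E.
Proof.
rewrite /norm_on -Lnorm_abse; congr Lnorm; apply/funext => x /=.
by rewrite /abs_on !patchE; case: (x \in D).
Qed.

Lemma centered_ball_dball (rho : R) :
  centered_ball n rho = dball [tuple 0 | i < n] rho.
Proof. by apply/seteqP; split => x; rewrite /centered_ball/= distC. Qed.

Lemma centered_ball_finite (rho : R) : 0 < rho ->
  (lebesgue R n (centered_ball n rho) < +oo)%E.
Proof.
move=> rho0; rewrite centered_ball_dball.
exact: le_lt_trans (dball_measure _ _ rho0) (ltry _).
Qed.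

End norm_on.

(* At y = x the kernel takes the value 0, because of the convention on the
   inverse of 0; this only concerns a null set of y. *)
Theorem theorem1p3 (R : realType) (n : nat) (alpha r nu : R)
    (n_ge1 : (1 <= n)%N) (alpha_gt0 : 0 < alpha) (alpha_lt : alpha < n%:R)
    (r_gt : n%:R / (n%:R - alpha) < r) (nu_gt : r < nu) :
  exists delta C : R, [/\ 0 < delta, delta < 1, 1 <= C &
    forall V h u : euclidean R n -> R,
      Lp_on (centered_ball n 3) (n%:R / alpha) V ->
      {ae lebesgue R n, forall x, centered_ball n 3 x -> 0 <= V x} ->
      (norm_on (centered_ball n 3) (n%:R / alpha) V <= delta%:E)%E ->
      Lp_on (centered_ball n 2) nu h ->
      Lp_on (centered_ball n 3) r u ->
      {ae lebesgue R n, forall x, centered_ball n 3 x -> 0 <= u x} ->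
      {ae lebesgue R n, forall x, centered_ball n 2 x ->
        ((u x)%:E <=
          (\int[lebesgue R n]_(y in centered_ball n 3)
            (V y * u y / (dist x y `^ (n%:R - alpha)))%:E) + (h x)%:E)%E} ->
      (norm_on (centered_ball n (1 / 2)) nu u <=
        C%:E * (norm_on (centered_ball n 3) r u +
                norm_on (centered_ball n 2) nu h))%E].
Proof.
have nu_gt' : n%:R / (n%:R - alpha) < nu by exact: lt_trans nu_gt.
have n0 : 0 < n%:R :> R by rewrite ltr0n.
have nn0 : n%:R != 0 :> R by rewrite gt_eqF.
have na0 : 0 < n%:R - alpha by rewrite subr_gt0.
have r1 : 1 < r by apply: lt_trans r_gt; rewrite ltr_pdivlMr// mul1r gtrBl.
have r0 : 0 < r by exact: lt_trans r1.
have nu0 : 0 < nu by exact: lt_trans nu_gt.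
have [Cr Cr0 bound_r] := riesz_potential_bound alpha n_ge1 alpha_gt0 alpha_lt r r_gt.
have [Cn Cn0 bound_nu] := riesz_potential_bound alpha n_ge1 alpha_gt0 alpha_lt nu nu_gt'.
have [c1 [c2 [c10 c20 weightK]]] := weight_kernel alpha n_ge1 alpha_lt.
pose mu := lebesgue R n.
pose w4 : R := 4 `^ (n%:R - alpha).
have w40 : 0 < w4 by rewrite powR_gt0.
(* The exponent of [V u]; it exceeds 1 because [r > n / (n - alpha)], so [V u] is integrable on
   [B_3]. *)
pose p := n%:R * r / (n%:R + r * alpha).
have s0 : 0 < n%:R + r * alpha by rewrite addr_gt0// mulr_gt0.
have p0 : 0 < p by rewrite divr_gt0// mulr_gt0.
have pE : p^-1 = (n%:R / alpha)^-1 + r^-1.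
  by rewrite /p; field; rewrite !gt_eqF.
have p1 : 1 < p.
  have : n%:R < r * (n%:R - alpha) by rewrite -ltr_pdivrMr.
  by rewrite ltr_pdivlMr// mul1r; lra.
pose p' := p / (p - 1).
have p'0 : 0 < p' by rewrite divr_gt0// subr_gt0.
have pp' : p^-1 + p'^-1 = 1.
  by rewrite /p'; field; rewrite !gt_eqF// subr_gt0.
pose B2 : set (euclidean R n) := centered_ball n 2.
pose B3 : set (euclidean R n) := centered_ball n 3.
have mB2 : measurable B2 := measurable_centered_ball 2.
have mB3 : measurable B3 := measurable_centered_ball 3.
have B2fin : (mu B2 < +oo)%E by exact: centered_ball_finite.
have B3fin : (mu B3 < +oo)%E by exact: centered_ball_finite.
have B23 x : B2 x -> B3 x by rewrite /B2 /B3 /centered_ball/= => ?; lra.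
pose c3 : R := fine (mu B3) `^ p'^-1.
have c30 : 0 <= c3 by exact: powR_ge0.
pose c6 : R := fine (mu B2) `^ nu^-1.
have c60 : 0 <= c6 by exact: powR_ge0.
(* Chosen so that the bound [A] on [|H|_nu] below satisfies [A <= c4 (X + Y)]. *)
pose c4 := c2 * c3 * c6 + w4.
have c2360 : 0 <= c2 * c3 * c6 by rewrite !mulr_ge0// ltW.
have c40 : 0 < c4 by rewrite ltr_wpDl.
have CC0 : 0 <= c1 * (Cr + Cn) by rewrite mulr_ge0 ?addr_ge0// ltW.
(* Makes the operator with potential [c1 V] halve the norms of both [L^r] and [L^nu]; the summand 1
   ensures [delta < 1]. *)
pose delta := (2 * (c1 * (Cr + Cn) + 1))^-1.
have delta0 : 0 < delta by rewrite invr_gt0; lra.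
have delta1 : delta < 1 by rewrite invf_lt1; lra.

have small C : 0 <= C -> C <= Cr + Cn -> C * (c1 * delta) <= 1 / 2.
  move=> C0 CC; rewrite /delta mulrA ler_pdivrMr; last by lra.
  have : c1 * C <= c1 * (Cr + Cn) by rewrite ler_wpM2l// ltW.
  by lra.
exists delta, (Num.max 1 (2 * c4)); split => //; first by rewrite le_max lexx.
move=> V h u [mV _] _ Vdelta [mh hfin] [mu' ufin] u_ge0 u_le.
set Nu := norm_on _ r u in ufin *; set Nh := norm_on _ nu h in hfin *.
have Nu0 : (0 <= Nu)%E by exact: Lnorm_ge0.
have Nh0 : (0 <= Nh)%E by exact: Lnorm_ge0.
have Nufin : Nu \is a fin_num by rewrite ge0_fin_numE.
have Nhfin : Nh \is a fin_num by rewrite ge0_fin_numE.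
pose u3 := abs_on B3 u; pose V3 := abs_on B3 V; pose h2 := abs_on B2 h.
have mu3 : measurable_fun setT u3 by exact: measurable_abs_on.
have mV3 : measurable_fun setT V3 by exact: measurable_abs_on.
have mh2 : measurable_fun setT h2 by exact: measurable_abs_on.
have u30 x : 0 <= u3 x by exact: abs_on_ge0.
have V30 x : 0 <= V3 x by exact: abs_on_ge0.
have h20 x : 0 <= h2 x by exact: abs_on_ge0.
pose w := weight alpha (n := n) : euclidean R n -> R.
have mw : measurable_fun setT w by exact: measurable_weight.
have w0 x : 0 <= w x by exact: weight_ge0.
pose U x := w x * u3 x.
have mU : measurable_fun setT U by exact: measurable_funM.
have U0 x : 0 <= U x by rewrite mulr_ge0.
(* The weight is at least 1 on [B_(1/2)], so [U] dominates [|u|] there. *)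
have half_le : (norm_on (centered_ball n (1 / 2)) nu u <= 'N[mu]_nu%:E[EFin \o U])%E.
  rewrite norm_onE; apply: ae_le_Lnorm => //.
  - apply: measurable_abs_on; first exact: measurable_centered_ball.
    apply: measurable_funS mu' => //; rewrite /centered_ball => x /= ?; lra.
  - exact: abs_on_ge0.
  apply: nearW => x; have [xh|xh] := pselect (centered_ball n (1 / 2) x).
    have x3 : B3 x by move: xh; rewrite /B3 /centered_ball/= => ?; lra.
    rewrite /U /u3 !abs_on_in// ler_peMl//.
    exact: weight_ge1.
  by rewrite abs_on_out.
apply: (le_trans half_le).
(* The lifting needs strictly positive bounds, while the norms may vanish: both are increased by
   [e'], where [2 c4 (2 e') = e]. *)
suff main (X Y : R) : 0 < X -> 0 < Y -> (Nu <= X%:E)%E -> (Nh <= Y%:E)%E ->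
    ('N[mu]_nu%:E[EFin \o U] <= (2 * c4 * (X + Y))%:E)%E.
  apply/lee_addgt0Pr => e e0; pose e' := e / (4 * c4).
  have e'0 : 0 < e' by rewrite divr_gt0// mulr_gt0.
  have lt_fin (N : \bar R) : N \is a fin_num -> (N <= (fine N + e')%:E)%E.
    by move=> Nfin; rewrite EFinD fineK// leeDl// lee_fin ltW.
  have fNu : 0 <= fine Nu by rewrite fine_ge0.
  have fNh : 0 <= fine Nh by rewrite fine_ge0.
  have X0 : 0 < fine Nu + e' by rewrite ltr_wpDl.
  have Y0 : 0 < fine Nh + e' by rewrite ltr_wpDl.
  apply: le_trans (main _ _ X0 Y0 (lt_fin _ Nufin) (lt_fin _ Nhfin)) _.
  have -> : (Nu + Nh = (fine Nu + fine Nh)%:E)%E by rewrite EFinD !fineK.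
  rewrite -EFinM -EFinD lee_fin.
  have -> : 2 * c4 * (fine Nu + e' + (fine Nh + e')) =
      2 * c4 * (fine Nu + fine Nh) + e.
    by rewrite /e'; field; rewrite gt_eqF.
  by rewrite lerD2r ler_wpM2r ?addr_ge0// le_max lexx orbT.
move=> {half_le}X0 Y0 NuX NhY.
have u3X : ('N[mu]_r%:E[EFin \o u3] <= X%:E)%E by rewrite -norm_onE.
have h2Y : ('N[mu]_nu%:E[EFin \o h2] <= Y%:E)%E by rewrite -norm_onE.
have V3d : ('N[mu]_(n%:R / alpha)%:E[EFin \o V3] <= delta%:E)%E by rewrite -norm_onE.
have Vu0 x : 0 <= V3 x * u3 x by rewrite mulr_ge0.
have mVu : measurable_fun setT (fun x => V3 x * u3 x) by exact: measurable_funM.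
pose M := (\int[mu]_y (V3 y * u3 y)%:E)%E.
have M0 : (0 <= M)%E by apply: integral_ge0 => y _; rewrite lee_fin.
(* Hoelder's inequality twice: [V u] against the indicator of [B_3], then [V] against [u], with
   [delta <= 1]. *)
have MX : (M <= (X * c3)%:E)%E.
  have -> : M = ('N[mu]_1[EFin \o ((fun x => V3 x * u3 x) \* \1_B3)%R])%E.
    rewrite Lnorm1; apply: eq_integral => y _ /=.
    have [y3|y3] := pselect (B3 y).
      by rewrite indicE mem_set// mulr1 ger0_norm.
    by rewrite /V3 abs_on_out// !mul0r normr0.
  have mI3 : measurable_fun setT (\1_B3 : euclidean R n -> R) by exact: measurable_indic.
  have Hld := hoelder mu mVu mI3 p0 p'0 pp'.
  apply: le_trans Hld _.
  rewrite [X in (_ <= X)%E]EFinM; apply: lee_pmul;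
    [exact: Lnorm_ge0|exact: Lnorm_ge0| |exact: Lnorm_indic_le].
  have na : 0 < n%:R / alpha by rewrite divr_gt0.
  apply: le_trans (Lnorm_mul_le mu V3 u3 p _ r delta X p0 na r0 pE
    (ltW delta0) (ltW X0) mV3 mu3 V30 u30 V3d u3X) _.
  by rewrite lee_fin ler_piMl// ltW.
have Mfin : M \is a fin_num by rewrite ge0_fin_numE//; apply: le_lt_trans MX (ltry _).
pose m := fine M.
have m0 : 0 <= m by rewrite fine_ge0.
have mX : m <= X * c3 by rewrite -lee_fin fineK.
(* The remainder of the localised inequality, with the weight in front of [|h|] replaced by its
   bound [w4]. *)
pose H x := c2 * m * \1_B2 x + w4 * h2 x.
have m1 : measurable_fun setT (fun x : euclidean R n => c2 * m * \1_B2 x).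
  by apply: measurable_funM => //; exact: measurable_indic.
have m2 : measurable_fun setT (fun x => w4 * h2 x) by exact: measurable_funM.
have cm0 : 0 <= c2 * m by rewrite mulr_ge0// ltW.
have mH : measurable_fun setT H by exact: measurable_funD.
have H0 x : 0 <= H x.
  by rewrite addr_ge0// mulr_ge0// ?indicE// ltW.
pose A := c2 * c3 * c6 * X + w4 * Y.
have A0 : 0 < A by rewrite ltr_wpDl ?mulr_gt0// mulr_ge0// ltW.
have HA : ('N[mu]_nu%:E[EFin \o H] <= A%:E)%E.
  have nu1 : 1 <= nu by rewrite ltW// (lt_trans r1).
  apply: le_trans (minkowski_EFin mu m1 m2 nu1) _.
  rewrite EFinD; apply: leeD.
    have I2 : ('N[mu]_nu%:E[EFin \o \1_B2] <= c6%:E)%E by exact: Lnorm_indic_le.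
    have mI2 : measurable_fun setT (\1_B2 : euclidean R n -> R) by exact: measurable_indic.
    have I20 x : 0 <= \1_B2 x :> R by rewrite indicE.
    apply: le_trans (Lnorm_scale_le mu \1_B2 nu _ _ nu0 cm0 c60 mI2 I20 I2) _.
    have -> : c2 * c3 * c6 * X = c2 * (X * c3) * c6 by ring.
    by rewrite lee_fin ler_wpM2r// ler_wpM2l// ltW.
  exact: (Lnorm_scale_le mu h2 nu _ _ nu0 (ltW w40) (ltW Y0) mh2 h20 h2Y).
suff UA : ('N[mu]_nu%:E[EFin \o U] <= (2 * A)%:E)%E.
  apply: le_trans UA _; rewrite lee_fin -mulrA ler_pM2l// /A /c4.
  rewrite mulrDl (mulrDr (_ * c6)) (mulrDr w4); apply: lerD.
    by rewrite lerDl mulr_ge0// ltW.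
  by rewrite lerDr mulr_ge0// ltW.
(* The constant [c1] is absorbed into the potential, so that the lifting applies to
   [U <= I U + H]. *)
pose V' x := c1 * V3 x.
have mV' : measurable_fun setT V' by exact: measurable_funM.
have V'0 x : 0 <= V' x by rewrite mulr_ge0// ltW.
have c1d : 0 < c1 * delta by rewrite mulr_gt0.
have V'd : ('N[mu]_(n%:R / alpha)%:E[EFin \o V'] <= (c1 * delta)%:E)%E.
  by apply: Lnorm_scale_le => //; rewrite ?divr_gt0 ?ltW.
have contr q C : 0 < q -> 0 <= C -> C <= Cr + Cn ->
    (forall (f : euclidean R n -> R) (P : R), measurable_fun setT f -> (forall x, 0 <= f x) -> 0 < P ->
      ('N[mu]_q%:E[EFin \o f] <= P%:E)%E ->
      (\int[mu]_(x in B2) (riesz mu (riesz_kernel alpha) (fun y => V' y * f y)%R x `^ q)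
        <= ((C * (c1 * delta * P)) `^ q)%:E)%E) ->
    contraction mu (riesz_kernel alpha) V' B2 q.
  move=> q0 C0 CC bnd f P mf f0 P0 fP; apply: le_trans (bnd f P mf f0 P0 fP) _.
  rewrite lee_fin; apply: (ge0_ler_powR (ltW q0)); rewrite ?nnegrE.
  - by rewrite !mulr_ge0// ltW.
  - by rewrite divr_ge0// ltW.
  - have -> : P / 2 = 1 / 2 * P by rewrite mul1r mulrC.
    by rewrite mulrA; apply: ler_wpM2r; [exact: ltW|exact: small].
pose Bd : R := w4 * X.
have Bd0 : 0 < Bd by rewrite mulr_gt0.
(* The kernel inequality for the weight, multiplied by [V u]; outside [B_3] both sides vanish. *)
have KU x y : B2 x -> weight alpha x * (riesz_kernel alpha x y * (V3 y * u3 y)) <=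
    riesz_kernel alpha x y * (V' y * U y) + c2 * (V3 y * u3 y).
  move=> x2; have [y3|y3] := pselect (B3 y); last first.
    by rewrite /U /V' /V3 /u3 !abs_on_out// !(mul0r, mulr0) addr0.
  rewrite mulrA [leRHS](_ : _ = (c1 * (weight alpha y * riesz_kernel alpha x y) + c2) *
    (V3 y * u3 y)); last by rewrite /V' /U /w; ring.
  exact: ler_wpM2r (weightK x y x2 y3).
have mkV x (f : euclidean R n -> R) : measurable_fun setT f ->
    measurable_fun setT (fun y => riesz_kernel alpha x y * f y).
  move=> mf; apply: measurable_funM => //.
  exact: (measurable_kernelr _ (measurable_riesz_kernel alpha)).
apply: (regularity_lifting mu (riesz_kernel alpha) _ _ V' B2 _ _ _ r nu U H A Bd).
- exact: measurable_riesz_kernel.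
- exact: riesz_kernel_ge0.
- exact: mV'.
- exact: V'0.
- exact: mB2.
- exact: ltW.
- exact: nu_gt.
- apply: (contr r Cr r0 Cr0); first by rewrite lerDl.
  by move=> f P mf f0 P0 fP; exact: bound_r.
- apply: (contr nu Cn nu0 Cn0); first by rewrite lerDr.
  by move=> f P mf f0 P0 fP; exact: bound_nu.
- exact: mU.
- exact: U0.
- by move=> x x2; rewrite /U /w weight_out// mul0r.
- exact: mH.
- exact: H0.
- exact: A0.
- exact: HA.
- exact: Bd0.
- have := Lnorm_scale_le mu u3 r _ _ r0 (ltW w40) (ltW X0) mu3 u30 u3X.
  apply: le_trans; apply: ae_le_Lnorm => //.
  + exact: measurable_funM.
  + by move=> x; rewrite mulr_ge0// ltW.
  + apply: nearW => x; rewrite /U ler_wpM2r//; exact: weight_le.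
(* What remains is [U <= I U + H] on [B_2]: multiply the assumed inequality by the weight at [x] and
   integrate [KU] in [y]. *)
apply: filterS2 u_ge0 u_le => x ux ule x2.
have {}ux := ux (B23 x x2); have {}ule := ule x2.
have u3E : u3 x = u x by rewrite /u3 abs_on_in ?ger0_norm//; exact: B23.
pose I3 := (\int[mu]_y (riesz_kernel alpha x y * (V3 y * u3 y))%:E)%E.
(* Passing to absolute values inside the integral brings in [V3] and [u3]. *)
have I3_le : (\int[mu]_(y in B3) (V y * u y / (dist x y `^ (n%:R - alpha)))%:E <= I3)%E.
  apply: le_trans (lee_abs _) _.
  apply: le_trans (le_abse_integral _ mB3 _) _.
    apply/measurable_EFinP; apply: measurable_funM; first exact: measurable_funM.
    apply: measurable_funTS.
    exact: (measurable_kernelr _ (measurable_riesz_kernel alpha)).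
  rewrite integral_mkcond.
  rewrite [leLHS](_ : _ = I3)//; apply: eq_integral => y _; rewrite patchE.
  case: ifPn => [/set_mem y3|/negP y3].
    have kE : `|(dist x y `^ (n%:R - alpha))^-1| = riesz_kernel alpha x y.
      exact: ger0_norm (riesz_kernel_ge0 alpha x y).
    by rewrite /V3 /u3 !abs_on_in//= !normrM kE mulrC.
  have {}y3 : ~ B3 y by move=> ?; apply: y3; rewrite inE.
  by rewrite /V3 abs_on_out// mul0r mulr0.
have hx : h x <= h2 x by rewrite /h2 abs_on_in// ler_norm.
have uI : ((u3 x)%:E <= I3 + (h2 x)%:E)%E.
  by rewrite u3E; apply: le_trans ule _; apply: leeD; [exact: I3_le|rewrite lee_fin].
rewrite /U EFinM.
apply: le_trans (lee_wpmul2l _ uI) _; first by rewrite lee_fin.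
rewrite muleDr ?ge0_adde_def//; last 2 first.
- by rewrite inE; apply: integral_ge0 => y _; rewrite lee_fin mulr_ge0// riesz_kernel_ge0.
- by rewrite inE lee_fin.
rewrite /H indicE mem_set// mulr1 [X in (_ <= _ + X)%E]EFinD addeA; apply: leeD; last first.
  by rewrite -EFinM lee_fin ler_wpM2r//; exact: weight_le.
rewrite EFinM /m fineK// -(ge0_integralZl_EFin _ measurableT); last 3 first.
- by move=> y _; rewrite lee_fin mulr_ge0// riesz_kernel_ge0.
- by apply/measurable_EFinP; exact: mkV.
- exact: w0.
rewrite -(ge0_integralZl_EFin _ measurableT); last 3 first.
- by move=> y _; rewrite lee_fin.
- exact/measurable_EFinP.
- exact: ltW.
have mkVU : measurable_fun setT (fun y => riesz_kernel alpha x y * (V' y * U y)).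
  by apply: mkV; exact: measurable_funM.
have mcVu : measurable_fun setT (fun y => c2 * (V3 y * u3 y)).
  exact: measurable_funM.
rewrite -(ge0_integralD _ measurableT); last 4 first.
- move=> y _; rewrite lee_fin; apply: mulr_ge0; first exact: riesz_kernel_ge0.
  by apply: mulr_ge0; [exact: V'0|exact: U0].
- exact/measurable_EFinP.
- by move=> y _; rewrite -EFinM lee_fin mulr_ge0// ltW.
- exact/measurable_EFinP.
apply: (ge0_le_integral _ measurableT).
- by move=> y _; rewrite -EFinM lee_fin mulr_ge0// mulr_ge0// riesz_kernel_ge0.
- apply/measurable_EFinP; apply: measurable_funM => //; exact: mkV.
- apply/measurable_EFinP; exact: measurable_funD.
- by move=> y _; rewrite -!EFinM -EFinD lee_fin; exact: KU.
Qed.
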